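(* Let $x\in(0,\infty)$ with associated sequence $(A_n)_{n\ge0}$ in $\mathrm{SL}(2,\mathbb{Z}_{\ge0})$, and let $M\in\mathrm{SL}(2,\mathbb{Z}_{\ge0})$. Then there is a constant $C_{x,M}>0$ depending only on $x$ and $M$ such that for every weakly holomorphic modular function $f$ for $\mathrm{SL}(2,\mathbb{Z})$ and every $n\ge0$, \[\big|I_f(MA_n)-I_f(A_n)\big|\le C_{x,M}\sup_{t\in[\pi/3,2\pi/3]}|f(e^{it})|.\]
   Context: Let $T=\begin{pmatrix}1&1\\0&1\end{pmatrix}$, $V=\begin{pmatrix}1&0\\1&1\end{pmatrix}$, acting by Möbius transformations. A weakly holomorphic modular function for $\mathrm{SL}(2,\mathbb{Z})$ is a holomorphic $\mathrm{SL}(2,\mathbb{Z})$-invariant function on $\mathbb{H}$ meromorphic at the cusp. For hyperbolic $A\in\mathrm{SL}(2,\mathbb{Z})$ with repelling/attracting fixed points $w,\tilde w$, let $Q(x,y)=ax^2+bxy+cy^2$ be the primitive integral form vanishing at $(w,1),(\tilde w,1)$ with $\mathrm{sgn}(a)=\mathrm{sgn}(w-\tilde w)$, $D=b^2-4ac$, and $I_f(A)=\int_{\tau_0}^{A\tau_0}\frac{f(\tau)\sqrt D}{Q(\tau,1)}d\tau$ ($\tau_0\in\mathbb{H}$ arbitrary); $I_f(A)=0$ if $A$ is not hyperbolic. The sequence associated to $x\in(0,\infty)$ (from the path in the Farey tree generated from $0/1,1/0$ converging to $x$) is the unique sequence $(A_n)$ in $\mathrm{SL}(2,\mathbb{Z}_{\ge0})$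 with $A_0=I$, $A_n^{-1}A_{n+1}\in\{T,V\}$ for all $n$, $A_n(1)\to x$, whose letters include infinitely many $T$'s and $V$'s if $x$ is irrational and are eventually all $V$ if $x$ is rational. *)

(* Defs.v *)
From Stdlib Require Import Reals ZArith QArith Qreals ClassicalEpsilon.
From Coquelicot Require Import Coquelicot.

Open Scope R_scope.

(** * Integral 2x2 matrices, [Mat2 a b c d] being the matrix with rows
    [(a, b)] and [(c, d)] *)

Record mat2 : Set := Mat2 { ma : Z; mb : Z; mc : Z; md : Z }.

Definition mat2_one : mat2 := Mat2 1 0 0 1.
Definition matT : mat2 := Mat2 1 1 0 1.
Definition matV : mat2 := Mat2 1 0 1 1.

Definition mat2_mul (A B : mat2) : mat2 :=
  Mat2 (ma A * ma B + mb A * mc B) (ma A * mb B + mb A * md B)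
       (mc A * ma B + md A * mc B) (mc A * mb B + md A * md B).

Definition mat2_det (A : mat2) : Z := (ma A * md A - mb A * mc A)%Z.
Definition mat2_trace (A : mat2) : Z := (ma A + md A)%Z.

(* The adjugate, which is the inverse in determinant 1, the only case used. *)
Definition mat2_inv (A : mat2) : mat2 := Mat2 (md A) (- mb A) (- mc A) (ma A).

Definition SL2Z (A : mat2) : Prop := mat2_det A = 1%Z.

Definition SL2Z_nonneg (A : mat2) : Prop :=
  SL2Z A /\ (0 <= ma A)%Z /\ (0 <= mb A)%Z /\ (0 <= mc A)%Z /\ (0 <= md A)%Z.

(** * Moebius action (only meaningful where the denominator is nonzero) *)

Definition moebR (A : mat2) (x : R) : R :=
  (IZR (ma A) * x + IZR (mb A)) / (IZR (mc A) * x + IZR (md A)).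

Definition moebC (A : mat2) (z : C) : C :=
  ((RtoC (IZR (ma A)) * z + RtoC (IZR (mb A)))
   / (RtoC (IZR (mc A)) * z + RtoC (IZR (md A))))%C.

Definition upper_half_plane (z : C) : Prop := 0 < Im z.

(** * Weakly holomorphic modular functions for SL(2,Z) *)

Definition holomorphic_at (f : C -> C) (z : C) : Prop :=
  ex_derive (K := C_AbsRing) (V := C_NormedModule) f z.

Definition cis (t : R) : C := (cos t, sin t).

(* q = exp (2 pi i tau) *)
Definition nome (tau : C) : C :=
  (RtoC (exp (- (2 * PI * Im tau))) * cis (2 * PI * Re tau))%C.

(* As a function of q, f is h(q) / q^N near q = 0, with h holomorphic there. *)
Definition meromorphic_at_cusp (f : C -> C) : Prop :=
  exists (N : nat) (h : C -> C) (r : R),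
    0 < r /\
    (forall q : C, Cmod q < r -> holomorphic_at h q) /\
    (forall tau : C, upper_half_plane tau -> Cmod (nome tau) < r ->
       f tau = (h (nome tau) / Cpow (nome tau) N)%C).

(* Values of f outside the upper half-plane are irrelevant. *)
Record weakly_holomorphic_modular (f : C -> C) : Prop := {
  whm_holomorphic :
    forall z : C, upper_half_plane z -> holomorphic_at f z;
  whm_invariant :
    forall (A : mat2) (z : C), SL2Z A -> upper_half_plane z ->
      f (moebC A z) = f z;
  whm_cusp : meromorphic_at_cusp f
}.

(** * Hyperbolic matrices and their quadratic forms *)

Definition hyperbolic (A : mat2) : Prop := (2 < Z.abs (mat2_trace A))%Z.

Definition hyperbolic_dec (A : mat2) : {hyperbolic A} + {~ hyperbolic A} :=
  Z_lt_dec 2 (Z.abs (mat2_trace A)).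

(* A hyperbolic element of SL(2,Z) does not fix infinity, so real fixed points
   suffice. *)
Definition fixed_point (A : mat2) (w : R) : Prop :=
  IZR (mc A) * w + IZR (md A) <> 0 /\ moebR A w = w.

Definition repelling_fixed_point (A : mat2) (w : R) : Prop :=
  fixed_point A w /\ 1 < Rabs (Derive (moebR A) w).

Definition attracting_fixed_point (A : mat2) (w : R) : Prop :=
  fixed_point A w /\ Rabs (Derive (moebR A) w) < 1.

(* The form a x^2 + b x y + c y^2. *)
Record qform : Set := QForm { qa : Z; qb : Z; qc : Z }.

Definition qform_primitive (q : qform) : Prop :=
  Z.gcd (Z.gcd (qa q) (qb q)) (qc q) = 1%Z.

Definition qform_eval (q : qform) (x y : C) : C :=
  (RtoC (IZR (qa q)) * x * x + RtoC (IZR (qb q)) * x * y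
   + RtoC (IZR (qc q)) * y * y)%C.

Definition qform_disc (q : qform) : Z := (qb q * qb q - 4 * qa q * qc q)%Z.

Definition is_cycle_form (A : mat2) (q : qform) : Prop :=
  exists w w' : R,
    repelling_fixed_point A w /\ attracting_fixed_point A w' /\
    qform_primitive q /\
    qform_eval q (RtoC w) (RtoC 1) = RtoC 0 /\
    qform_eval q (RtoC w') (RtoC 1) = RtoC 0 /\
    sign (IZR (qa q)) = sign (w - w').

(* For A hyperbolic in SL(2,Z) exactly one form satisfies [is_cycle_form A]. *)
Definition cycle_form (A : mat2) : qform :=
  epsilon (inhabits (QForm 0 0 0)) (is_cycle_form A).

(** * Cycle integrals *)

Definition segment_integral (g : C -> C) (z0 z1 : C) : C :=
  RInt (V := C_R_CompleteNormedModule)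
    (fun t : R => (g (z0 + RtoC t * (z1 - z0)) * (z1 - z0))%C) 0 1.

(* The integrand is holomorphic on the (convex) upper half-plane, so the
   integral from tau0 to A tau0 is taken along the segment; its value does not
   depend on the path, nor on tau0. *)
Definition cycle_integral (f : C -> C) (tau0 : C) (A : mat2) : C :=
  if hyperbolic_dec A then
    let q := cycle_form A in
    segment_integral
      (fun tau : C =>
         (f tau * RtoC (sqrt (IZR (qform_disc q)))
          / qform_eval q tau (RtoC 1))%C)
      tau0 (moebC A tau0)
  else RtoC 0.

(** * The sequence associated to a positive real number *)

Definition letter (A : nat -> mat2) (n : nat) : mat2 :=
  mat2_mul (mat2_inv (A n)) (A (S n)).

Definition rational (x : R) : Prop := exists r : Q, x = Q2R r.

Record associated_sequence (x : R) (A : nat -> mat2) : Prop := {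
  as_SL2 : forall n : nat, SL2Z_nonneg (A n);
  as_start : A 0%nat = mat2_one;
  as_step : forall n : nat, letter A n = matT \/ letter A n = matV;
  as_limit : is_lim_seq (fun n : nat => moebR (A n) 1) x;
  as_irrational : ~ rational x ->
    (forall N : nat, exists n : nat, (N <= n)%nat /\ letter A n = matT) /\
    (forall N : nat, exists n : nat, (N <= n)%nat /\ letter A n = matV);
  as_rational : rational x ->
    exists N : nat, forall n : nat, (N <= n)%nat -> letter A n = matV
}.

(** * The supremum of |f| over the arc of the unit circle from exp(i pi/3) to
    exp(2 i pi/3) *)

Definition arc_sup (f : C -> C) : R :=
  real (Lub_Rbar (fun y : R => exists t : R,
    PI / 3 <= t <= 2 * PI / 3 /\ y = Cmod (f (cis t)))).

(* Main.v *)
Require Import Defs.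
From Stdlib Require Import Reals ZArith Lra Lia List Bool ClassicalEpsilon.
From Coquelicot Require Import Coquelicot.
Open Scope R_scope.

(* Write [omega (w, w')] for [dtau / (tau - w) - dtau / (tau - w')]; for the
   fixed points w, w' of A it is the form [sqrt D dtau / Q(tau, 1)], and it is
   equivariant under SL(2,Z).  Since T and V both send rho = exp(2 i pi/3) to
   rho + 1, the path from rho to A rho splits along the word of A in T and V,
   and I_f(A) becomes a sum, one term per letter, of integrals of
   f omega(- v_i, z_i) over the arc from rho to rho + 1, with v_i, z_i > 0.
   Along the word, v_i moves by y -> y + 1 or y -> y / (y + 1), and z_i moves by
   the same maps backwards.  Under these maps |ln v - ln v'| decreases at each
   step by at least |v - v'| / ((1 + v) (1 + v')), which bounds the change of
   the form on the arc; so the comparison of I_f(M A_n) with I_f(A_n) telescopes.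
   It remains to start the telescope in a compact subset of (0, oo), which holds
   once a prefix of the word contains both T and V; the length of such a prefix
   is at most about x + 1/x. *)

(** * Complex derivatives *)

(** The obstacle is the repelling point - v: the attracting point is governed by the first letters
    of a word, but v by its last ones, so v may approach 0 or infinity as n grows. Comparing from
    the first letter is therefore hopeless. Since M is a word too, M A_n and A_n share all letters
    of A_n, and any positive v is confined to [1/N, N] by reading N common letters among which both
    T and V occur. The letters read before that cost one bounded arc integral each. I_f is defined
    on a segment from an arbitrary base point, whereas f is bounded only on the arc. Moving the path
    needs Cauchy's theorem, obtained as the existence of primitives of f omega on the upper
    half-plane. With primitives, equivariance becomes composition with a Moebius map, and arc
    integrals are bounded by the mean value inequality. In the constant, pi/3 is the length of the
    arc, 4 bounds the coefficient of omega there, and 4 ln (m + N) bounds two logarithmic distances,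
    m being the length of the word of M. *)

Notation C_derive_at f z l :=
  (is_derive (K := C_AbsRing) (V := C_NormedModule) f z l).
Notation path_derive f t l :=
  (is_derive (K := R_AbsRing) (V := C_R_NormedModule) f t l).

Lemma C_derive_at_iff (f : C -> C) (z l : C) :
  C_derive_at f z l <->
  forall eps, 0 < eps -> exists d, 0 < d /\ forall y, Cmod (y - z) < d ->
    Cmod (f y - f z - (y - z) * l)%C <= eps * Cmod (y - z).
Proof.
  split.
  - intros [_ H] eps Heps.
    destruct (H z (fun P HP => HP) (mkposreal _ Heps)) as [d Hd].
    exists d; split; [apply cond_pos|]. intros y Hy. apply (Hd y Hy).
  - intros H. split.
    + apply (is_linear_scal_l (K := C_AbsRing) (V := C_NormedModule) l).
    + intros x Hx eps.
      assert (x = z) as ->.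
      { symmetry. apply (is_filter_lim_locally_unique (K := C_AbsRing)
          (V := AbsRing_NormedModule C_AbsRing) z x). exact Hx. }
      destruct (H eps (cond_pos eps)) as [d [Hd H']].
      exists (mkposreal _ Hd). intros y Hy. apply (H' y Hy).
Qed.

Lemma path_derive_iff (f : R -> C) (t : R) (l : C) :
  path_derive f t l <->
  forall eps, 0 < eps -> exists d, 0 < d /\ forall s, Rabs (s - t) < d ->
    Cmod (f s - f t - RtoC (s - t) * l)%C <= eps * Rabs (s - t).
Proof.
  assert (E : forall s, (f s - f t - RtoC (s - t) * l)%C =
    minus (G := C_R_NormedModule) (minus (f s) (f t)) (scal (minus s t) l)).
  { intros s. unfold minus, plus, opp, scal; simpl.
    apply injective_projections; simpl; unfold minus, plus, opp, scal, mult; simpl;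
    unfold mult; simpl; ring. }
  split.
  - intros [_ H] eps Heps.
    destruct (H t (fun P HP => HP) (mkposreal _ Heps)) as [d Hd].
    exists d; split; [apply cond_pos|]. intros y Hy. rewrite E, Cmod_norm. apply (Hd y Hy).
  - intros H. split.
    + apply (is_linear_scal_l (K := R_AbsRing) (V := C_R_NormedModule) l).
    + intros x Hx eps.
      assert (x = t) as ->.
      { symmetry. apply (is_filter_lim_locally_unique (K := R_AbsRing)
          (V := AbsRing_NormedModule R_AbsRing) t x). exact Hx. }
      destruct (H eps (cond_pos eps)) as [d [Hd H']].
      exists (mkposreal _ Hd). intros y Hy. specialize (H' y Hy). rewrite E, Cmod_norm in H'. apply H'.
Qed.

Lemma C_derive_at_comp_path (G : C -> C) (c : R -> C) (t : R) (l dc : C) :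
  C_derive_at G (c t) l -> path_derive c t dc ->
  path_derive (fun s => G (c s)) t (l * dc)%C.
Proof.
  intros HG Hc. rewrite C_derive_at_iff in HG. rewrite path_derive_iff in Hc.
  apply path_derive_iff. intros eps Heps.
  pose proof (Cmod_ge_0 l) as Hl. pose proof (Cmod_ge_0 dc) as Hdc.
  (* The error is that of [G] plus [l] times that of [c]; [e1] and [e2] make each at most eps/2. The
     cap 1 on [e2] gives |c s - c t| <= (|dc| + 1) |s - t|. *)
  set (e1 := eps / 2 / (Cmod dc + 1)).
  assert (He1 : 0 < e1) by (unfold e1; apply Rdiv_lt_0_compat; lra).
  set (e2 := Rmin 1 (eps / 2 / (Cmod l + 1))).
  assert (He2 : 0 < e2).
  { apply Rmin_glb_lt; [lra|]. apply Rdiv_lt_0_compat; lra. }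
  assert (He2' : e2 <= 1) by apply Rmin_l.
  assert (He2'' : (Cmod l + 1) * e2 <= eps / 2).
  { apply Rle_trans with ((Cmod l + 1) * (eps / 2 / (Cmod l + 1))).
    - apply Rmult_le_compat_l; [lra|apply Rmin_r].
    - right; field; lra. }
  destruct (HG _ He1) as [d1 [Hd1 H1]]. destruct (Hc _ He2) as [d2 [Hd2 H2]].
  exists (Rmin d2 (d1 / (Cmod dc + 1))). split.
  { apply Rmin_glb_lt; [lra|]. apply Rdiv_lt_0_compat; lra. }
  intros s Hs.
  assert (Hs2 : Rabs (s - t) < d2) by (eapply Rlt_le_trans; [exact Hs|apply Rmin_l]).
  assert (Hs1 : Rabs (s - t) < d1 / (Cmod dc + 1)) by (eapply Rlt_le_trans; [exact Hs|apply Rmin_r]).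
  specialize (H2 s Hs2).
  pose proof (Rabs_pos (s - t)) as Hp.
  assert (Hcs : Cmod (c s - c t) <= (Cmod dc + 1) * Rabs (s - t)).
  { replace (c s - c t)%C with ((c s - c t - RtoC (s - t) * dc) + RtoC (s - t) * dc)%C by ring.
    eapply Rle_trans; [apply Cmod_triangle|]. rewrite Cmod_mult, Cmod_R. nra. }
  assert (Hcd : Cmod (c s - c t) < d1).
  { eapply Rle_lt_trans; [exact Hcs|].
    apply Rmult_lt_compat_l with (r := Cmod dc + 1) in Hs1; [|lra].
    replace ((Cmod dc + 1) * (d1 / (Cmod dc + 1))) with d1 in Hs1 by (field; lra). exact Hs1. }
  specialize (H1 _ Hcd).
  replace (G (c s) - G (c t) - RtoC (s - t) * (l * dc))%C with
    ((G (c s) - G (c t) - (c s - c t) * l) + l * (c s - c t - RtoC (s - t) * dc))%C by ring.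
  eapply Rle_trans; [apply Cmod_triangle|]. rewrite Cmod_mult.
  assert (e1 * Cmod (c s - c t) <= eps / 2 * Rabs (s - t)).
  { apply Rle_trans with (e1 * ((Cmod dc + 1) * Rabs (s - t))).
    - apply Rmult_le_compat_l; lra.
    - right; unfold e1; field; lra. }
  assert (Cmod l * Cmod (c s - c t - RtoC (s - t) * dc) <= Cmod l * (e2 * Rabs (s - t)))
    by (apply Rmult_le_compat_l; lra).
  nra.
Qed.

Lemma C_derive_at_minus (f g : C -> C) (z a b : C) :
  C_derive_at f z a -> C_derive_at g z b -> C_derive_at (fun y => f y - g y)%C z (a - b)%C.
Proof. exact (is_derive_minus (K := C_AbsRing) (V := C_NormedModule) f g z a b). Qed.

Lemma C_derive_at_plus (f g : C -> C) (z a b : C) :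
  C_derive_at f z a -> C_derive_at g z b -> C_derive_at (fun y => f y + g y)%C z (a + b)%C.
Proof. exact (is_derive_plus (K := C_AbsRing) (V := C_NormedModule) f g z a b). Qed.

(** Both structures of C as a module over itself give the same remainder estimate, so only linearity
    is rechecked. The product and chain rules are phrased for the second structure. *)
Lemma C_derive_at_self_iff (f : C -> C) (z l : C) :
  C_derive_at f z l <->
  is_derive (K := C_AbsRing) (V := AbsRing_NormedModule C_AbsRing) f z l.
Proof.
  split; intros [_ H]; (split; [apply is_linear_scal_l|exact H]).
Qed.

Lemma C_derive_at_mult (f g : C -> C) (z a b : C) :
  C_derive_at f z a -> C_derive_at g z b ->
  C_derive_at (fun y => f y * g y)%C z (a * g z + f z * b)%C.
Proof.
  rewrite !C_derive_at_self_iff. intros Hf Hg.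
  apply (is_derive_mult (K := C_AbsRing) f g z a b Hf Hg). exact Cmult_comm.
Qed.

Lemma C_derive_at_comp (f g : C -> C) (z a b : C) :
  C_derive_at f (g z) a -> C_derive_at g z b ->
  C_derive_at (fun y => f (g y)) z (b * a)%C.
Proof.
  rewrite (C_derive_at_self_iff g). intros Hf Hg.
  exact (is_derive_comp (K := C_AbsRing) (V := C_NormedModule) f g z a b Hf Hg).
Qed.

Lemma C_derive_at_id (z : C) : C_derive_at (fun y => y) z (RtoC 1).
Proof. apply C_derive_at_self_iff. exact (is_derive_id (K := C_AbsRing) z). Qed.

Lemma C_derive_at_const (c z : C) : C_derive_at (fun _ => c) z (RtoC 0).
Proof. exact (is_derive_const (K := C_AbsRing) (V := C_NormedModule) c z). Qed.

Lemma C_derive_at_inv (z : C) :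
  z <> RtoC 0 -> C_derive_at (fun y => / y)%C z (- / (z * z))%C.
Proof.
  intros Hz. apply C_derive_at_iff. intros eps Heps.
  assert (Hm : 0 < Cmod z) by (now apply Cmod_gt_0). set (m := Cmod z) in *.
  (* The remainder is (y - z)^2 / (z^2 y). The first radius keeps |y| >= m/2, the second then makes
     the quotient at most eps |y - z|. *)
  exists (Rmin (m / 2) (eps * (m * m * m) / 2)). split.
  { apply Rmin_glb_lt; [lra|]. assert (0 < m * m * m) by (repeat apply Rmult_lt_0_compat; lra). nra. }
  intros y Hy.
  assert (Hy1 : Cmod (y - z) < m / 2) by (eapply Rlt_le_trans; [exact Hy|apply Rmin_l]).
  assert (Hy2 : Cmod (y - z) < eps * (m * m * m) / 2) by (eapply Rlt_le_trans; [exact Hy|apply Rmin_r]).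
  assert (Hym : m / 2 <= Cmod y).
  { assert (m <= Cmod y + Cmod (y - z)); [|lra].
    unfold m. replace z with (y + - (y - z))%C at 1 by ring.
    eapply Rle_trans; [apply Cmod_triangle|]. rewrite Cmod_opp. lra. }
  assert (Hy0 : y <> RtoC 0) by (apply Cmod_gt_0; lra).
  replace (/ y - / z - (y - z) * - / (z * z))%C with ((y - z) * (y - z) / (z * z * y))%C
    by (field; split; assumption).
  rewrite Cmod_div by (repeat apply Cmult_neq_0; assumption).
  rewrite !Cmod_mult. fold m.
  apply Rle_div_l; [repeat apply Rmult_lt_0_compat; lra|].
  pose proof (Cmod_ge_0 (y - z)).
  rewrite (Rmult_comm eps), Rmult_assoc. apply Rmult_le_compat_l; [assumption|].
  apply Rle_trans with (eps * (m * m * (m / 2))); [lra|].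
  apply Rmult_le_compat_l; [lra|]. apply Rmult_le_compat_l; nra.
Qed.

Lemma C_derive_at_ext (f g : C -> C) (z a b : C) :
  (forall y, f y = g y) -> a = b -> C_derive_at f z a -> C_derive_at g z b.
Proof.
  intros H -> Hf. exact (is_derive_ext (K := C_AbsRing) (V := C_NormedModule) f g z b H Hf).
Qed.

Lemma Rabs_Im_le_Cmod (z : C) : Rabs (Im z) <= Cmod z.
Proof. eapply Rle_trans; [apply Rmax_r|apply Rmax_Cmod]. Qed.

Lemma holomorphic_at_continuous (f : C -> C) (z : C) :
  holomorphic_at f z ->
  forall eps, 0 < eps -> exists d, 0 < d /\ forall y, Cmod (y - z) < d -> Cmod (f y - f z) < eps.
Proof.
  intros [l H] eps Heps. rewrite C_derive_at_iff in H.
  destruct (H 1 Rlt_0_1) as [d [Hd H']].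
  pose proof (Cmod_ge_0 l).
  exists (Rmin d (eps / (Cmod l + 1 + 1))). split.
  { apply Rmin_glb_lt; [lra|]. apply Rdiv_lt_0_compat; lra. }
  intros y Hy.
  assert (Hy1 : Cmod (y - z) < d) by (eapply Rlt_le_trans; [exact Hy|apply Rmin_l]).
  assert (Hy2 : Cmod (y - z) < eps / (Cmod l + 1 + 1)) by (eapply Rlt_le_trans; [exact Hy|apply Rmin_r]).
  specialize (H' y Hy1).
  replace (f y - f z)%C with ((f y - f z - (y - z) * l) + (y - z) * l)%C by ring.
  eapply Rle_lt_trans; [apply Cmod_triangle|]. rewrite Cmod_mult.
  apply Rlt_div_r in Hy2; [|lra]. pose proof (Cmod_ge_0 (y - z)). lra.
Qed.

Lemma continuous_path_iff (f : R -> C) (t : R) :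
  continuous (U := C_R_NormedModule) f t <->
  forall eps, 0 < eps -> exists d, 0 < d /\ forall s, Rabs (s - t) < d -> Cmod (f s - f t) < eps.
Proof.
  split.
  - intros H eps Heps.
    destruct (proj1 (filterlim_locally (U := C_R_NormedModule) f (f t)) H
      (mkposreal (eps / 2) ltac:(lra))) as [d Hd].
    exists d; split; [apply cond_pos|]. intros s Hs. specialize (Hd s Hs).
    (* Balls of the uniform structure are squares, which costs a factor [sqrt 2] against [Cmod]; the
       radius eps/2 absorbs it. *)
    apply C_NormedModule_mixin_compat2 in Hd. simpl in Hd.
    eapply Rlt_le_trans; [exact Hd|].
    assert (sqrt 2 <= 2).
    { replace 2 with (sqrt (2 * 2)) at 2 by (apply sqrt_square; lra). apply sqrt_le_1_alt. lra. }
    nra.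
  - intros H. apply (filterlim_locally (U := C_R_NormedModule) f (f t)). intros eps.
    destruct (H eps (cond_pos eps)) as [d [Hd H']].
    exists (mkposreal _ Hd). intros s Hs. apply C_NormedModule_mixin_compat1. apply H'. exact Hs.
Qed.

Lemma holomorphic_continuous_path (g : C -> C) (c : R -> C) (t : R) :
  holomorphic_at g (c t) -> continuous (U := C_R_NormedModule) c t ->
  continuous (U := C_R_NormedModule) (fun s => g (c s)) t.
Proof.
  rewrite !continuous_path_iff. intros Hg Hc eps Heps.
  destruct (holomorphic_at_continuous _ _ Hg eps Heps) as [d [Hd H1]].
  destruct (Hc d Hd) as [d' [Hd' H2]]. exists d'. split; [lra|]. intros s Hs. apply H1, H2, Hs.
Qed.

(** * Integrals along segments *)

Ltac as_C := match goal with |- ?a = ?b => change (@eq C a b) end.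

Definition holomorphic_on_H (g : C -> C) : Prop :=
  forall z, upper_half_plane z -> holomorphic_at g z.

Definition seg (z0 z1 : C) (t : R) : C := (z0 + RtoC t * (z1 - z0))%C.

Lemma path_derive_seg (z0 z1 : C) (t : R) : path_derive (seg z0 z1) t (z1 - z0)%C.
Proof.
  apply path_derive_iff. intros eps Heps. exists 1. split; [lra|]. intros s _.
  unfold seg. replace (_ - _ - _)%C with (RtoC 0).
  - rewrite Cmod_0. apply Rmult_le_pos; [lra|apply Rabs_pos].
  - rewrite RtoC_minus. ring.
Qed.

Lemma continuous_seg (z0 z1 : C) (t : R) : continuous (U := C_R_NormedModule) (seg z0 z1) t.
Proof.
  apply (ex_derive_continuous (K := R_AbsRing) (V := C_R_NormedModule)).
  exists (z1 - z0)%C. apply path_derive_seg.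
Qed.

Lemma seg_Im_ge (m : R) (z0 z1 : C) (t : R) :
  0 <= t <= 1 -> m <= Im z0 -> m <= Im z1 -> m <= Im (seg z0 z1 t).
Proof.
  intros Ht H0 H1. unfold seg, Im in *. simpl. nra.
Qed.

Lemma seg_upper (z0 z1 : C) (t : R) :
  0 <= t <= 1 -> upper_half_plane z0 -> upper_half_plane z1 -> upper_half_plane (seg z0 z1 t).
Proof.
  unfold upper_half_plane. intros Ht H0 H1.
  apply Rlt_le_trans with (Rmin (Im z0) (Im z1)); [now apply Rmin_glb_lt|].
  apply seg_Im_ge; [assumption|apply Rmin_l|apply Rmin_r].
Qed.

Lemma Cmod_seg_minus_l (z0 z1 : C) (t : R) :
  0 <= t <= 1 -> Cmod (seg z0 z1 t - z0) <= Cmod (z1 - z0).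
Proof.
  intros Ht. unfold seg. replace (_ - _)%C with (RtoC t * (z1 - z0))%C by ring.
  rewrite Cmod_mult, Cmod_R, Rabs_pos_eq by lra. pose proof (Cmod_ge_0 (z1 - z0)). nra.
Qed.

Lemma continuous_seg_integrand (g : C -> C) (z0 z1 : C) (t : R) :
  holomorphic_at g (seg z0 z1 t) ->
  continuous (U := C_R_NormedModule) (fun s => g (seg z0 z1 s) * (z1 - z0))%C t.
Proof.
  intros Hg.
  assert (H : holomorphic_at (fun z => g z * (z1 - z0))%C (seg z0 z1 t)).
  { destruct Hg as [l Hl]. exists (l * (z1 - z0) + g (seg z0 z1 t) * RtoC 0)%C.
    apply (C_derive_at_mult g (fun _ => (z1 - z0)%C)); [exact Hl|apply C_derive_at_const]. }
  apply (holomorphic_continuous_path _ _ _ H), continuous_seg.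
Qed.

Lemma is_RInt_segment (g : C -> C) (z0 z1 : C) :
  (forall t, 0 <= t <= 1 -> holomorphic_at g (seg z0 z1 t)) ->
  is_RInt (V := C_R_NormedModule) (fun t => g (seg z0 z1 t) * (z1 - z0))%C 0 1
    (segment_integral g z0 z1).
Proof.
  intros H. apply (RInt_correct (V := C_R_CompleteNormedModule)).
  apply (ex_RInt_continuous (V := C_R_CompleteNormedModule)).
  intros t Ht. rewrite Rmin_left, Rmax_right in Ht by lra.
  apply continuous_seg_integrand, H, Ht.
Qed.

Lemma segment_integral_primitive (g G : C -> C) (z0 z1 : C) :
  (forall t, 0 <= t <= 1 -> holomorphic_at g (seg z0 z1 t)) ->
  (forall t, 0 <= t <= 1 -> C_derive_at G (seg z0 z1 t) (g (seg z0 z1 t))) ->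
  segment_integral g z0 z1 = (G z1 - G z0)%C.
Proof.
  intros Hg HG. apply (is_RInt_unique (V := C_R_CompleteNormedModule)).
  replace (G z1 - G z0)%C with (minus (G := C_R_CompleteNormedModule)
    (G (seg z0 z1 1)) (G (seg z0 z1 0))).
  - apply (is_RInt_derive (V := C_R_CompleteNormedModule) (fun t => G (seg z0 z1 t))
      (fun t => g (seg z0 z1 t) * (z1 - z0))%C);
    intros t Ht; rewrite Rmin_left, Rmax_right in Ht by lra.
    + apply C_derive_at_comp_path; [now apply HG|apply path_derive_seg].
    + apply continuous_seg_integrand, Hg, Ht.
  - unfold seg. change (minus (G := C_R_CompleteNormedModule)) with Cminus.
    f_equal; f_equal; ring.
Qed.

Lemma segment_integral_minus (g1 g2 : C -> C) (z0 z1 : C) :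
  (forall t, 0 <= t <= 1 -> holomorphic_at g1 (seg z0 z1 t)) ->
  (forall t, 0 <= t <= 1 -> holomorphic_at g2 (seg z0 z1 t)) ->
  segment_integral (fun z => g1 z - g2 z)%C z0 z1 =
  (segment_integral g1 z0 z1 - segment_integral g2 z0 z1)%C.
Proof.
  intros H1 H2. apply (is_RInt_unique (V := C_R_CompleteNormedModule)).
  apply (is_RInt_ext (V := C_R_NormedModule)
    (fun t => minus (G := C_R_NormedModule) (g1 (seg z0 z1 t) * (z1 - z0))%C
      (g2 (seg z0 z1 t) * (z1 - z0))%C)).
  - intros t _. change (minus (G := C_R_NormedModule)) with Cminus. as_C. unfold seg. ring.
  - apply (is_RInt_minus (V := C_R_NormedModule)); now apply is_RInt_segment.
Qed.

Lemma Cmod_segment_integral_le (g : C -> C) (z0 z1 : C) (B : R) :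
  (forall t, 0 <= t <= 1 -> holomorphic_at g (seg z0 z1 t)) ->
  (forall t, 0 <= t <= 1 -> Cmod (g (seg z0 z1 t)) <= B) ->
  Cmod (segment_integral g z0 z1) <= B * Cmod (z1 - z0).
Proof.
  intros Hg HB. rewrite (Cmod_norm (segment_integral _ _ _)).
  replace (B * Cmod (z1 - z0)) with ((1 - 0) * (B * Cmod (z1 - z0))) by ring.
  apply (norm_RInt_le_const (V := C_R_NormedModule)
    (fun t => g (seg z0 z1 t) * (z1 - z0))%C 0 1 _ _ Rle_0_1).
  - intros t Ht. rewrite <- Cmod_norm, Cmod_mult.
    apply Rmult_le_compat_r; [apply Cmod_ge_0|now apply HB].
  - now apply is_RInt_segment.
Qed.

Lemma scal_C_R (u : R) (z : C) : scal (V := C_R_NormedModule) u z = (RtoC u * z)%C.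
Proof.
  apply injective_projections; simpl; unfold scal, mult; simpl; unfold mult; simpl; ring.
Qed.

Lemma segment_integral_swap (g : C -> C) (z0 z1 : C) :
  (forall t, 0 <= t <= 1 -> holomorphic_at g (seg z0 z1 t)) ->
  segment_integral g z1 z0 = (- segment_integral g z0 z1)%C.
Proof.
  intros Hg. apply (is_RInt_unique (V := C_R_CompleteNormedModule)).
  apply (is_RInt_ext (V := C_R_NormedModule)
    (fun y => scal (V := C_R_NormedModule) (-1) (g (seg z0 z1 (-1 * y + 1)) * (z1 - z0))%C)).
  - intros t _. rewrite scal_C_R. as_C. unfold seg. rewrite RtoC_plus, RtoC_mult.
    replace (z0 + _ * _)%C with (z1 + t * (z0 - z1))%C by ring. ring.
  - apply (is_RInt_comp_lin (V := C_R_NormedModule)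
      (fun t => g (seg z0 z1 t) * (z1 - z0))%C (-1) 1 0 1).
    replace (-1 * 0 + 1) with 1 by ring. replace (-1 * 1 + 1) with 0 by ring.
    apply (is_RInt_swap (V := C_R_NormedModule)). now apply is_RInt_segment.
Qed.

Definition midpoint (z0 z1 : C) : C := ((z0 + z1) / RtoC 2)%C.

Lemma segment_integral_split (g : C -> C) (z0 z1 : C) :
  (forall t, 0 <= t <= 1 -> holomorphic_at g (seg z0 z1 t)) ->
  segment_integral g z0 z1 =
  (segment_integral g z0 (midpoint z0 z1) + segment_integral g (midpoint z0 z1) z1)%C.
Proof.
  intros Hg. assert (H2 : RtoC 2 <> RtoC 0) by (intros E; apply RtoC_inj in E; lra).
  assert (Hh : RtoC (/ 2) = (/ RtoC 2)%C) by (now rewrite RtoC_inv by lra).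
  set (F := fun t => (g (seg z0 z1 t) * (z1 - z0))%C).
  assert (He : forall a b, 0 <= a <= b -> b <= 1 ->
    ex_RInt (V := C_R_CompleteNormedModule) F a b).
  { intros a b Ha Hb. apply (ex_RInt_continuous (V := C_R_CompleteNormedModule)).
    intros t Ht. rewrite Rmin_left, Rmax_right in Ht by lra.
    apply continuous_seg_integrand, Hg. lra. }
  unfold segment_integral at 1. change (RInt (V := C_R_CompleteNormedModule) F 0 1 =
    (segment_integral g z0 (midpoint z0 z1) + segment_integral g (midpoint z0 z1) z1)%C).
  rewrite <- (RInt_Chasles (V := C_R_CompleteNormedModule) F 0 (/ 2) 1) by (apply He; lra).
  change (plus (G := C_R_CompleteNormedModule)) with Cplus. symmetry. f_equal.
  - pose proof (RInt_comp_lin (V := C_R_CompleteNormedModule) F (/ 2) 0 0 1) as E.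
    replace (/ 2 * 0 + 0) with 0 in E by lra. replace (/ 2 * 1 + 0) with (/ 2) in E by lra.
    rewrite <- E by (apply He; lra). clear E.
    apply (RInt_ext (V := C_R_CompleteNormedModule)). intros t _.
    rewrite scal_C_R. as_C. unfold F, seg, midpoint. rewrite RtoC_plus, RtoC_mult, Hh.
    replace (z0 + RtoC t * ((z0 + z1) / 2 - z0))%C with (z0 + (/ 2 * t + 0) * (z1 - z0))%C
      by (field; exact H2). field; exact H2.
  - pose proof (RInt_comp_lin (V := C_R_CompleteNormedModule) F (/ 2) (/ 2) 0 1) as E.
    replace (/ 2 * 0 + / 2) with (/ 2) in E by lra. replace (/ 2 * 1 + / 2) with 1 in E by lra.
    rewrite <- E by (apply He; lra). clear E.
    apply (RInt_ext (V := C_R_CompleteNormedModule)). intros t _.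
    rewrite scal_C_R. as_C. unfold F, seg, midpoint. rewrite RtoC_plus, RtoC_mult, Hh.
    replace ((z0 + z1) / 2 + RtoC t * (z1 - (z0 + z1) / 2))%C
      with (z0 + (/ 2 * t + / 2) * (z1 - z0))%C
      by (field; exact H2). field; exact H2.
Qed.

(** * Goursat's lemma in the upper half-plane *)

Definition triangle : Type := (C * C * C)%type.

Definition triangle_integral (g : C -> C) (T : triangle) : C :=
  let '(a, b, c) := T in
  (segment_integral g a b + segment_integral g b c + segment_integral g c a)%C.

Definition sides_le (L : R) (T : triangle) : Prop :=
  let '(a, b, c) := T in
  Cmod (b - a) <= L /\ Cmod (c - b) <= L /\ Cmod (a - c) <= L.

(** A uniform lower bound, unlike mere positivity, survives the limit of nested triangles and so
    keeps their common point in the open half-plane. *)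
Definition Im_ge (m : R) (T : triangle) : Prop :=
  let '(a, b, c) := T in m <= Im a /\ m <= Im b /\ m <= Im c.

Lemma holomorphic_seg (g : C -> C) (m : R) (z0 z1 : C) :
  holomorphic_on_H g -> 0 < m -> m <= Im z0 -> m <= Im z1 ->
  forall t, 0 <= t <= 1 -> holomorphic_at g (seg z0 z1 t).
Proof.
  intros Hg Hm H0 H1 t Ht. apply Hg, seg_upper; unfold upper_half_plane; lra.
Qed.

Lemma Im_midpoint (z0 z1 : C) : Im (midpoint z0 z1) = (Im z0 + Im z1) / 2.
Proof. unfold midpoint, Im, Cdiv. simpl. field. Qed.

Lemma RtoC2_neq_0 : RtoC 2 <> RtoC 0.
Proof. intros E. apply RtoC_inj in E. lra. Qed.

Lemma Cmod_half (z : C) : Cmod (z / RtoC 2) = Cmod z / 2.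
Proof. rewrite Cmod_div by apply RtoC2_neq_0. rewrite Cmod_R, Rabs_pos_eq by lra. reflexivity. Qed.

(** Each side of the medial triangle [p], [q], [r] is traversed twice, in opposite directions, and
    cancels. *)
Lemma triangle_integral_split (g : C -> C) (m : R) (a b c : C) :
  holomorphic_on_H g -> 0 < m -> Im_ge m (a, b, c) ->
  let p := midpoint a b in let q := midpoint b c in let r := midpoint c a in
  triangle_integral g (a, b, c) =
  (triangle_integral g (a, p, r) + triangle_integral g (p, b, q)
   + triangle_integral g (r, q, c) + triangle_integral g (p, q, r))%C.
Proof.
  intros Hg Hm (Ha & Hb & Hc) p q r. unfold triangle_integral.
  assert (Hp : m <= Im p) by (unfold p; rewrite Im_midpoint; lra).
  assert (Hq : m <= Im q) by (unfold q; rewrite Im_midpoint; lra).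
  assert (Hr : m <= Im r) by (unfold r; rewrite Im_midpoint; lra).
  pose proof (fun x y => holomorphic_seg g m x y Hg Hm) as HS.
  rewrite (segment_integral_split g a b), (segment_integral_split g b c),
    (segment_integral_split g c a) by (apply HS; assumption).
  fold p q r.
  rewrite (segment_integral_swap g q p), (segment_integral_swap g r q),
    (segment_integral_swap g p r) by (apply HS; assumption).
  ring.
Qed.

(** One of the four subtriangles carries at least a quarter of the integral. The bound on the
    displacement of the first vertex makes the iterates a Cauchy sequence. *)
Lemma triangle_refine (g : C -> C) (m : R) (T : triangle) :
  holomorphic_on_H g -> 0 < m -> Im_ge m T ->
  exists T' : triangle,
    Im_ge m T' /\ Cmod (triangle_integral g T) <= 4 * Cmod (triangle_integral g T') /\
    forall L, sides_le L T -> sides_le (L / 2) T' /\ Cmod (fst (fst T') - fst (fst T)) <= L.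
Proof.
  destruct T as [[a b] c]. intros Hg Hm HT.
  pose proof (triangle_integral_split g m a b c Hg Hm HT) as E. simpl in E.
  destruct HT as (Ha & Hb & Hc).
  set (p := midpoint a b) in *. set (q := midpoint b c) in *. set (r := midpoint c a) in *.
  assert (Hp : m <= Im p) by (unfold p; rewrite Im_midpoint; lra).
  assert (Hq : m <= Im q) by (unfold q; rewrite Im_midpoint; lra).
  assert (Hr : m <= Im r) by (unfold r; rewrite Im_midpoint; lra).
  assert (Epa : (p - a = (b - a) / RtoC 2)%C) by (unfold p, midpoint; field; apply RtoC2_neq_0).
  assert (Ebp : (b - p = (b - a) / RtoC 2)%C) by (unfold p, midpoint; field; apply RtoC2_neq_0).
  assert (Eqb : (q - b = (c - b) / RtoC 2)%C) by (unfold q, midpoint; field; apply RtoC2_neq_0).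
  assert (Ecq : (c - q = (c - b) / RtoC 2)%C) by (unfold q, midpoint; field; apply RtoC2_neq_0).
  assert (Erc : (r - c = (a - c) / RtoC 2)%C) by (unfold r, midpoint; field; apply RtoC2_neq_0).
  assert (Ear : (a - r = (a - c) / RtoC 2)%C) by (unfold r, midpoint; field; apply RtoC2_neq_0).
  assert (Erp : (r - p = (c - b) / RtoC 2)%C) by (unfold r, p, midpoint; field; apply RtoC2_neq_0).
  assert (Epq : (p - q = (a - c) / RtoC 2)%C) by (unfold p, q, midpoint; field; apply RtoC2_neq_0).
  assert (Eqr : (q - r = (b - a) / RtoC 2)%C) by (unfold q, r, midpoint; field; apply RtoC2_neq_0).
  assert (Era : (r - a = - ((a - c) / RtoC 2))%C) by (rewrite <- Ear; ring).
  assert (Erq : (r - q = - ((b - a) / RtoC 2))%C) by (rewrite <- Eqr; ring).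
  assert (Eqp : (q - p = - ((a - c) / RtoC 2))%C) by (rewrite <- Epq; ring).
  assert (Epr : (p - r = - ((c - b) / RtoC 2))%C) by (rewrite <- Erp; ring).
  set (I0 := triangle_integral g (a, b, c)) in *.
  assert (HI : Cmod I0 <= Cmod (triangle_integral g (a, p, r)) + Cmod (triangle_integral g (p, b, q))
     + Cmod (triangle_integral g (r, q, c)) + Cmod (triangle_integral g (p, q, r))).
  { unfold I0, triangle_integral in *. rewrite E.
    eapply Rle_trans; [apply Cmod_triangle|]. apply Rplus_le_compat_r.
    eapply Rle_trans; [apply Cmod_triangle|]. apply Rplus_le_compat_r. apply Cmod_triangle. }
  assert (Hsub : forall T', In T' ((a, p, r) :: (p, b, q) :: (r, q, c) :: (p, q, r) :: nil) ->
    Im_ge m T' /\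
    forall L, sides_le L (a, b, c) -> sides_le (L / 2) T' /\ Cmod (fst (fst T') - a) <= L).
  { intros T' HT'. split.
    - destruct HT' as [<-|[<-|[<-|[<-|[]]]]]; simpl; auto.
    - intros L (S1 & S2 & S3).
      pose proof (Cmod_ge_0 (b - a)).
      destruct HT' as [<-|[<-|[<-|[<-|[]]]]]; unfold sides_le; cbn [fst snd];
      rewrite ?Epa, ?Ebp, ?Eqb, ?Ecq, ?Erc, ?Ear, ?Erp, ?Epq, ?Eqr, ?Era, ?Erq, ?Eqp, ?Epr;
      rewrite ?Cmod_opp, ?Cmod_half; repeat split; try lra.
      replace (a - a)%C with (RtoC 0) by ring. rewrite Cmod_0. lra. }
  assert (Hex : exists T', In T' ((a, p, r) :: (p, b, q) :: (r, q, c) :: (p, q, r) :: nil) /\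
    Cmod I0 <= 4 * Cmod (triangle_integral g T')).
  { destruct (Rle_lt_dec (Cmod I0) (4 * Cmod (triangle_integral g (a, p, r))));
      [exists (a, p, r); simpl; auto|].
    destruct (Rle_lt_dec (Cmod I0) (4 * Cmod (triangle_integral g (p, b, q))));
      [exists (p, b, q); simpl; auto|].
    destruct (Rle_lt_dec (Cmod I0) (4 * Cmod (triangle_integral g (r, q, c))));
      [exists (r, q, c); simpl; auto|].
    exists (p, q, r). split; [simpl; auto|]. lra. }
  destruct Hex as (T' & HT' & HI'). exists T'. destruct (Hsub T' HT'). auto.
Qed.

(** The intervals of radius 2 D / 2^n about [u n] are nested; the limit of their left ends lies in
    all of them, which gives the explicit rate. *)
Lemma geometric_cauchy_limit (u : nat -> R) (D : R) :
  (forall n, Rabs (u (S n) - u n) <= D / 2 ^ n) ->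
  exists l, forall n, Rabs (u n - l) <= 2 * D / 2 ^ n.
Proof.
  intros H.
  assert (Hpow : forall n, 0 < 2 ^ n) by (intros n; apply pow_lt; lra).
  set (v := fun n => u n - 2 * D / 2 ^ n). set (w := fun n => u n + 2 * D / 2 ^ n).
  assert (HD : forall n, 0 <= D / 2 ^ n)
    by (intros n; eapply Rle_trans; [apply Rabs_pos|apply H]).
  assert (Hhalf : forall n, D / 2 ^ (S n) = D / 2 ^ n / 2)
    by (intros n; simpl; field; pose proof (Hpow n); lra).
  assert (Hs : forall n, 2 * D / 2 ^ n = 2 * (D / 2 ^ n))
    by (intros n; unfold Rdiv; ring).
  assert (Hv : forall n, v n <= v (S n)).
  { intros n. unfold v. rewrite !Hs, Hhalf. specialize (H n). apply Rabs_le_between in H. lra. }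
  assert (Hw : forall n, w (S n) <= w n).
  { intros n. unfold w. rewrite !Hs, Hhalf. specialize (H n). apply Rabs_le_between in H. lra. }
  assert (Hvw : forall n, v n <= w n).
  { intros n. unfold v, w. rewrite Hs. specialize (HD n). lra. }
  assert (Hvm : forall n k, v n <= v (n + k)%nat).
  { intros n k. induction k; [rewrite Nat.add_0_r; lra|].
    rewrite Nat.add_succ_r. eapply Rle_trans; [exact IHk|apply Hv]. }
  assert (Hwm : forall n k, w (n + k)%nat <= w n).
  { intros n k. induction k; [rewrite Nat.add_0_r; lra|].
    rewrite Nat.add_succ_r. eapply Rle_trans; [apply Hw|exact IHk]. }
  assert (Hall : forall m n, v m <= w n).
  { intros m n. apply Rle_trans with (v (m + n)%nat); [apply Hvm|].
    apply Rle_trans with (w (m + n)%nat); [apply Hvw|].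
    rewrite Nat.add_comm. apply Hwm. }
  destruct (ex_finite_lim_seq_incr v (w 0%nat) Hv (fun m => Hall m 0%nat)) as [l Hl].
  exists l. intros n.
  pose proof (is_lim_seq_incr_compare v l Hl Hv n) as H1.
  pose proof (is_lim_seq_le v (fun _ => w n) l (w n) (fun m => Hall m n) Hl (is_lim_seq_const _)) as H2.
  simpl in H2. unfold v, w in *. apply Rabs_le_between. lra.
Qed.

Lemma Cmod_le_Re_Im (z : C) : Cmod z <= Rabs (Re z) + Rabs (Im z).
Proof.
  unfold Cmod, Re, Im. apply Rsqr_incr_0_var.
  - rewrite Rsqr_sqrt by nra. unfold Rsqr.
    rewrite <- (pow2_abs (fst z)), <- (pow2_abs (snd z)).
    pose proof (Rabs_pos (fst z)). pose proof (Rabs_pos (snd z)). nra.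
  - pose proof (Rabs_pos (fst z)). pose proof (Rabs_pos (snd z)). lra.
Qed.

Lemma geometric_cauchy_limit_C (u : nat -> C) (D : R) :
  (forall n, Cmod (u (S n) - u n) <= D / 2 ^ n) ->
  exists l, forall n, Cmod (u n - l) <= 4 * D / 2 ^ n.
Proof.
  intros H.
  destruct (geometric_cauchy_limit (fun n => Re (u n)) D) as [x Hx].
  { intros n. eapply Rle_trans; [apply (re_le_Cmod (u (S n) - u n))|apply H]. }
  destruct (geometric_cauchy_limit (fun n => Im (u n)) D) as [y Hy].
  { intros n. eapply Rle_trans; [apply (Rabs_Im_le_Cmod (u (S n) - u n))|apply H]. }
  exists (x, y). intros n. eapply Rle_trans; [apply Cmod_le_Re_Im|].
  specialize (Hx n). specialize (Hy n).
  change (Rabs (Re (u n) - x) + Rabs (Im (u n) - y) <= 4 * D / 2 ^ n).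
  replace (4 * D / 2 ^ n) with (2 * D / 2 ^ n + 2 * D / 2 ^ n) by (unfold Rdiv; ring). lra.
Qed.

Lemma triangle_refinements (g : C -> C) (m L : R) (T : triangle) :
  holomorphic_on_H g -> 0 < m -> Im_ge m T -> sides_le L T ->
  exists S : nat -> triangle, forall n,
    Im_ge m (S n) /\ sides_le (L / 2 ^ n) (S n) /\
    Cmod (triangle_integral g T) <= 4 ^ n * Cmod (triangle_integral g (S n)) /\
    Cmod (fst (fst (S (n + 1)%nat)) - fst (fst (S n))) <= L / 2 ^ n.
Proof.
  intros Hg Hm HT HL.
  (* Making the relation conditional on [Im_ge] gives every triangle a successor, so that choice
     yields a function that can be iterated. *)
  set (P := fun T T' : triangle => Im_ge m T -> Im_ge m T' /\
    Cmod (triangle_integral g T) <= 4 * Cmod (triangle_integral g T') /\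
    forall L, sides_le L T -> sides_le (L / 2) T' /\ Cmod (fst (fst T') - fst (fst T)) <= L).
  assert (HP : forall T, { T' | P T T' }).
  { intros T0. apply constructive_indefinite_description.
    destruct (excluded_middle_informative (Im_ge m T0)) as [H|H].
    - destruct (triangle_refine g m T0 Hg Hm H) as [T' H']. exists T'. intros _. exact H'.
    - exists T0. intros H'. contradiction. }
  set (S := fix S n := match n with O => T | Datatypes.S k => proj1_sig (HP (S k)) end).
  assert (HS : forall n, P (S n) (S (Datatypes.S n))) by (intros n; apply (proj2_sig (HP (S n)))).
  assert (Hinv : forall n, Im_ge m (S n) /\ sides_le (L / 2 ^ n) (S n) /\
    Cmod (triangle_integral g T) <= 4 ^ n * Cmod (triangle_integral g (S n))).
  { induction n as [|n (I1 & I2 & I3)].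
    - simpl. replace (L / 1) with L by field. repeat split; auto. lra.
    - destruct (HS n I1) as (J1 & J2 & J3). split; [exact J1|]. split.
      + replace (L / 2 ^ Datatypes.S n) with (L / 2 ^ n / 2); [apply J3, I2|].
        simpl. field. apply pow_nonzero. lra.
      + apply Rle_trans with (1 := I3).
        replace (4 ^ Datatypes.S n) with (4 ^ n * 4) by (simpl; ring). rewrite Rmult_assoc.
        apply Rmult_le_compat_l; [|exact J2]. apply pow_le. lra. }
  exists S. intros n. destruct (Hinv n) as (I1 & I2 & I3). repeat (split; [assumption|]).
  rewrite Nat.add_1_r. destruct (HS n I1) as (_ & _ & J3). apply J3, I2.
Qed.

(** A primitive of the first-order Taylor polynomial at [z0], whose integral around a closed
    triangle therefore vanishes. *)
Lemma affine_derive (a b z0 z : C) :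
  C_derive_at (fun y => a * y + b / RtoC 2 * ((y - z0) * (y - z0)))%C z (a + (z - z0) * b)%C.
Proof.
  assert (H1 : C_derive_at (fun y => y - z0)%C z (RtoC 1 - RtoC 0)%C)
    by (apply (C_derive_at_minus (fun y => y)); [apply C_derive_at_id|apply C_derive_at_const]).
  pose proof (C_derive_at_mult _ _ _ _ _ H1 H1) as H2.
  pose proof (C_derive_at_mult _ _ _ _ _ (C_derive_at_const (b / RtoC 2)%C z) H2) as H3.
  pose proof (C_derive_at_mult _ _ _ _ _ (C_derive_at_const a z) (C_derive_at_id z)) as H4.
  pose proof (C_derive_at_plus _ _ _ _ _ H4 H3) as H5.
  refine (C_derive_at_ext _ _ _ _ _ _ _ H5); [reflexivity|].
  field.
Qed.

Lemma affine_holomorphic (a b z0 : C) : holomorphic_on_H (fun y => a + (y - z0) * b)%C.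
Proof.
  intros z _. exists (RtoC 0 + ((RtoC 1 - RtoC 0) * b + (z - z0) * RtoC 0))%C.
  apply C_derive_at_plus; [apply C_derive_at_const|].
  apply (C_derive_at_mult (fun y => y - z0)%C (fun _ => b)); [|apply C_derive_at_const].
  apply (C_derive_at_minus (fun y => y)); [apply C_derive_at_id|apply C_derive_at_const].
Qed.

(** After n quarterings the integral has lost a factor of at most 4^n. Near the limit point only the
    error of the Taylor polynomial contributes, at most 18 eps (L / 2^n)^2, so the powers cancel and
    eps is arbitrary. *)
Lemma goursat (g : C -> C) (T : triangle) (m : R) :
  holomorphic_on_H g -> 0 < m -> Im_ge m T -> triangle_integral g T = RtoC 0.
Proof.
  intros Hg Hm HT.
  assert (HL : exists L, 0 < L /\ sides_le L T).
  { destruct T as [[a b] c].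
    pose proof (Cmod_ge_0 (b - a)). pose proof (Cmod_ge_0 (c - b)). pose proof (Cmod_ge_0 (a - c)).
    exists (Cmod (b - a) + Cmod (c - b) + Cmod (a - c) + 1). simpl. repeat split; lra. }
  destruct HL as (L & HL0 & HL).
  destruct (triangle_refinements g m L T Hg Hm HT HL) as [S HS].
  destruct (geometric_cauchy_limit_C (fun n => fst (fst (S n))) L) as [z Hz].
  { intros n. rewrite <- Nat.add_1_r. apply HS. }
  assert (Hpow : forall n, 0 < 2 ^ n) by (intros n; apply pow_lt; lra).
  (* With h = L / 2^n, the first vertex is within 4 h of the limit, the others within 5 h, and every
     point of a side within 6 h. Three sides of length at most h then give the factor 18. *)
  assert (Hsmall : forall d, 0 < d -> exists n, 6 * L / 2 ^ n < d).
  { intros d Hd. destruct (Pow_x_infinity 2 ltac:(rewrite Rabs_pos_eq; lra) (6 * L / d + 1)) as [N HN].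
    exists N. specialize (HN N (le_n N)). rewrite Rabs_pos_eq in HN by (left; apply Hpow).
    apply Rlt_div_l; [apply Hpow|]. apply Rmult_lt_reg_r with (/ d); [now apply Rinv_0_lt_compat|].
    replace (d * 2 ^ N * / d) with (2 ^ N) by (field; lra). unfold Rdiv in HN. lra. }
  assert (Hz0 : upper_half_plane z).
  { destruct (Hsmall m Hm) as [n Hn]. destruct (HS n) as (I1 & _). specialize (Hz n). simpl in Hz.
    destruct (S n) as [[a b] c]. destruct I1 as (I1 & _). simpl in Hz.
    pose proof (Rabs_Im_le_Cmod (a - z)) as Hi.
    assert (Hr : Rabs (Im a - Im z) <= 4 * L / 2 ^ n) by exact (Rle_trans _ _ _ Hi Hz).
    apply Rabs_le_between in Hr. unfold upper_half_plane.
    assert (0 < L / 2 ^ n) by (apply Rdiv_lt_0_compat; auto).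
    unfold Rdiv in *. lra. }
  destruct (Hg z Hz0) as [l Hl]. rewrite C_derive_at_iff in Hl.
  assert (Heps : forall eps, 0 < eps -> Cmod (triangle_integral g T) <= 18 * eps * L * L).
  { intros eps He. destruct (Hl eps He) as (d & Hd & Hdz).
    destruct (Hsmall d Hd) as [n Hn]. destruct (HS n) as (I1 & I2 & I3 & _). specialize (Hz n).
    simpl in Hz. destruct (S n) as [[a b] c]. cbn [fst] in Hz.
    destruct I1 as (Ia & Ib & Ic). destruct I2 as (S1 & S2 & S3).
    set (h := L / 2 ^ n) in *.
    assert (Hh : 0 < h) by (apply Rdiv_lt_0_compat; auto).
    replace (4 * L / 2 ^ n) with (4 * h) in Hz by (unfold h, Rdiv; ring).
    replace (6 * L / 2 ^ n) with (6 * h) in Hn by (unfold h, Rdiv; ring).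
    set (A := fun y => (g z + (y - z) * l)%C).
    assert (HA : holomorphic_on_H A) by apply affine_holomorphic.
    assert (Hside : forall p q, m <= Im p -> m <= Im q -> Cmod (q - p) <= h -> Cmod (p - z) <= 5 * h ->
      Cmod (segment_integral g p q - segment_integral A p q) <= eps * (6 * h) * h).
    { intros p q Hp Hq Hpq Hpz.
      rewrite <- segment_integral_minus by (apply (holomorphic_seg _ m); assumption).
      eapply Rle_trans; [apply Cmod_segment_integral_le with (B := eps * (6 * h))|].
      - intros t Ht. destruct (holomorphic_seg _ _ _ _ Hg Hm Hp Hq t Ht) as [l1 Hl1].
        destruct (holomorphic_seg _ _ _ _ HA Hm Hp Hq t Ht) as [l2 Hl2].
        exists (l1 - l2)%C. apply C_derive_at_minus; assumption.
      - intros t Ht.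
        assert (Hs : Cmod (seg p q t - z) <= 6 * h).
        { replace (seg p q t - z)%C with ((seg p q t - p) + (p - z))%C by ring.
          eapply Rle_trans; [apply Cmod_triangle|]. pose proof (Cmod_seg_minus_l p q t Ht). lra. }
        unfold A. replace (g (seg p q t) - (g z + (seg p q t - z) * l))%C
          with (g (seg p q t) - g z - (seg p q t - z) * l)%C by ring.
        eapply Rle_trans; [apply Hdz; lra|]. apply Rmult_le_compat_l; lra.
      - apply Rmult_le_compat_l; [|exact Hpq]. apply Rmult_le_pos; lra. }
    assert (HA0 : (segment_integral A a b + segment_integral A b c + segment_integral A c a)%C = RtoC 0).
    { rewrite !(fun p q H => segment_integral_primitive A _ p q H
        (fun t _ => affine_derive (g z) l z (seg p q t)))
        by (apply (holomorphic_seg _ m); assumption). ring. }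
    assert (Hbz : Cmod (b - z) <= 5 * h).
    { replace (b - z)%C with ((b - a) + (a - z))%C by ring.
      eapply Rle_trans; [apply Cmod_triangle|]. lra. }
    assert (Hcz : Cmod (c - z) <= 5 * h).
    { replace (c - z)%C with (- (a - c) + (a - z))%C by ring.
      eapply Rle_trans; [apply Cmod_triangle|]. rewrite Cmod_opp. lra. }
    pose proof (Hside a b Ia Ib S1 ltac:(lra)) as B1.
    pose proof (Hside b c Ib Ic S2 Hbz) as B2.
    pose proof (Hside c a Ic Ia S3 Hcz) as B3.
    assert (HI : Cmod (triangle_integral g (a, b, c)) <= 18 * eps * h * h).
    { simpl.
      replace (segment_integral g a b + segment_integral g b c + segment_integral g c a)%C with
        ((segment_integral g a b - segment_integral A a b) + (segment_integral g b c - segment_integral A b c)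
         + (segment_integral g c a - segment_integral A c a)
         + (segment_integral A a b + segment_integral A b c + segment_integral A c a))%C by ring.
      rewrite HA0, Cplus_0_r.
      eapply Rle_trans; [apply Cmod_triangle|].
      eapply Rle_trans; [apply Rplus_le_compat_r, Cmod_triangle|]. lra. }
    eapply Rle_trans; [exact I3|].
    apply Rle_trans with (4 ^ n * (18 * eps * h * h)).
    - apply Rmult_le_compat_l; [apply pow_le; lra|exact HI].
    - right. unfold h. replace (4 ^ n) with (2 ^ n * 2 ^ n).
      + field. pose proof (Hpow n). lra.
      + rewrite <- Rpow_mult_distr. f_equal. }
  apply Cmod_eq_0. apply Rle_antisym; [|apply Cmod_ge_0].
  apply le_epsilon. intros eps He.
  assert (HLL : 0 < 18 * L * L) by nra.
  eapply Rle_trans; [apply (Heps (eps / (18 * L * L))); now apply Rdiv_lt_0_compat|].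
  right. field. lra.
Qed.

(** The half-plane is convex, so integration along segments from i is defined. Goursat on the
    triangle i, z, y turns the increment into the integral over [z, y], and continuity of [g] at z
    concludes. *)
Lemma holomorphic_primitive (g : C -> C) :
  holomorphic_on_H g ->
  exists G : C -> C, forall z, upper_half_plane z -> C_derive_at G z (g z).
Proof.
  intros Hg. exists (fun z => segment_integral g Ci z). intros z Hz.
  apply C_derive_at_iff. intros eps He.
  destruct (holomorphic_at_continuous g z (Hg z Hz) eps He) as (d & Hd & Hc).
  unfold upper_half_plane in Hz.
  exists (Rmin d (Im z / 2)). split; [apply Rmin_glb_lt; lra|].
  intros y Hy.
  assert (Hyd : Cmod (y - z) < d) by (eapply Rlt_le_trans; [exact Hy|apply Rmin_l]).
  assert (Hyz : Cmod (y - z) < Im z / 2) by (eapply Rlt_le_trans; [exact Hy|apply Rmin_r]).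
  assert (Hiy : Im z / 2 <= Im y).
  { pose proof (Rabs_Im_le_Cmod (y - z)) as Hm.
    assert (Hr : Rabs (Im y - Im z) < Im z / 2) by exact (Rle_lt_trans _ _ _ Hm Hyz).
    apply Rabs_def2 in Hr. lra. }
  set (m := Rmin 1 (Im z / 2)).
  assert (Hm : 0 < m) by (apply Rmin_glb_lt; lra).
  assert (Hm1 : m <= Im Ci) by apply Rmin_l.
  assert (Hm2 : m <= Im z / 2) by apply Rmin_r.
  assert (Hm3 : m <= Im z) by lra. assert (Hm4 : m <= Im y) by lra.
  pose proof (goursat g (Ci, z, y) m Hg Hm (conj Hm1 (conj Hm3 Hm4))) as E.
  simpl in E. rewrite (segment_integral_swap g Ci y) in E by (apply (holomorphic_seg _ m); assumption).
  assert (Hconst : segment_integral (fun _ => g z) z y = ((y - z) * g z)%C).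
  { rewrite (segment_integral_primitive _ (fun w => w * g z)%C).
    - ring.
    - intros t _. exists (RtoC 0). apply C_derive_at_const.
    - intros t _. refine (C_derive_at_ext (fun w => w * g z)%C _ _ _ _ (fun _ => eq_refl) _
        (C_derive_at_mult _ _ _ _ _ (C_derive_at_id _) (C_derive_at_const (g z) _))). ring. }
  assert (Hk : holomorphic_on_H (fun _ => g z)).
  { intros w _. exists (RtoC 0). apply C_derive_at_const. }
  replace (segment_integral g Ci y - segment_integral g Ci z - (y - z) * g z)%C
    with (segment_integral (fun w => g w - g z)%C z y).
  2: { rewrite (segment_integral_minus g (fun _ => g z)), Hconst
         by (apply (holomorphic_seg _ m); assumption).
       transitivity ((segment_integral g Ci z + segment_integral g z y + - segment_integral g Ci y)
         + (segment_integral g Ci y - segment_integral g Ci z - (y - z) * g z))%C; [ring|].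
       rewrite E. ring. }
  apply Cmod_segment_integral_le.
  - intros t Ht. destruct (holomorphic_seg _ _ _ _ Hg Hm Hm3 Hm4 t Ht) as [l1 Hl1].
    exists (l1 - RtoC 0)%C. apply (C_derive_at_minus g (fun _ => g z)); [exact Hl1|apply C_derive_at_const].
  - intros t Ht. left. apply Hc. eapply Rle_lt_trans; [apply Cmod_seg_minus_l, Ht|exact Hyd].
Qed.

(** * The mean value inequality for paths in C, and constancy on the half-plane *)

Lemma is_derive_Re_mult (c : C) (phi : R -> C) (t : R) (l : C) :
  path_derive phi t l -> is_derive (fun s => Re (c * phi s)%C) t (Re (c * l)%C).
Proof.
  intros H. rewrite path_derive_iff in H. apply is_derive_Reals. intros eps He.
  pose proof (Cmod_ge_0 c) as Hc.
  destruct (H (eps / 2 / (Cmod c + 1))) as (d & Hd & Hd').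
  { apply Rdiv_lt_0_compat; lra. }
  exists (mkposreal d Hd). intros h Hh Hhd. simpl in Hhd.
  specialize (Hd' (t + h)). replace (t + h - t) with h in Hd' by ring. specialize (Hd' Hhd).
  assert (Hh' : 0 < Rabs h) by now apply Rabs_pos_lt.
  replace ((Re (c * phi (t + h)%R)%C - Re (c * phi t)%C) / h - Re (c * l)%C)
    with (Re (c * (phi (t + h)%R - phi t - RtoC h * l))%C / h)
    by (unfold Re; simpl; field; exact Hh).
  unfold Rdiv at 1. rewrite Rabs_mult, Rabs_inv. apply Rlt_div_l; [exact Hh'|].
  eapply Rle_lt_trans; [apply re_le_Cmod|]. rewrite Cmod_mult.
  apply Rle_lt_trans with (Cmod c * (eps / 2 / (Cmod c + 1) * Rabs h)).
  - apply Rmult_le_compat_l; assumption.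
  - apply Rle_lt_trans with ((Cmod c + 1) * (eps / 2 / (Cmod c + 1) * Rabs h)).
    + apply Rmult_le_compat_r; [|lra].
      apply Rmult_le_pos; [|lra]. apply Rlt_le, Rdiv_lt_0_compat; lra.
    + replace ((Cmod c + 1) * (eps / 2 / (Cmod c + 1) * Rabs h)) with (eps / 2 * Rabs h)
        by (field; lra). nra.
Qed.

(** Projecting onto the direction of the total displacement D reduces this to the real mean value
    theorem: the real part of conj(D) phi grows by exactly |D|^2. *)
Lemma path_mean_value (phi dphi : R -> C) (a b B : R) :
  a <= b ->
  (forall t, a <= t <= b -> path_derive phi t (dphi t) /\ Cmod (dphi t) <= B) ->
  Cmod (phi b - phi a) <= B * (b - a).
Proof.
  intros Hab H. set (D := (phi b - phi a)%C).
  destruct (MVT_gen (fun s => Re (Cconj D * phi s)%C) a b (fun s => Re (Cconj D * dphi s)%C))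
    as (xi & Hxi & E).
  - intros t Ht. rewrite Rmin_left, Rmax_right in Ht by lra.
    apply is_derive_Re_mult, H. lra.
  - intros t Ht. rewrite Rmin_left, Rmax_right in Ht by lra.
    apply continuity_pt_filterlim.
    apply (ex_derive_continuous (K := R_AbsRing) (V := R_NormedModule)).
    exists (Re (Cconj D * dphi t)%C). apply is_derive_Re_mult, H, Ht.
  - rewrite Rmin_left, Rmax_right in Hxi by lra.
    assert (HD : Cmod D * Cmod D = Re (Cconj D * dphi xi)%C * (b - a)).
    { rewrite <- E. replace (Cmod D * Cmod D) with (Cmod D ^ 2) by ring.
      rewrite Cmod2_alt. unfold D, Re, Im. simpl. ring. }
    destruct (H xi Hxi) as [_ HB].
    pose proof (Rle_trans _ _ _ (Rle_abs _) (re_le_Cmod (Cconj D * dphi xi)%C)) as Hre.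
    rewrite Cmod_mult, Cmod_conj in Hre.
    destruct (Rle_lt_or_eq_dec _ _ (Cmod_ge_0 D)) as [Hp|Hz].
    + apply Rmult_le_reg_l with (Cmod D); [exact Hp|]. rewrite HD, <- Rmult_assoc.
      apply Rmult_le_compat_r; [lra|]. nra.
    + rewrite <- Hz. apply Rmult_le_pos; [|lra].
      eapply Rle_trans; [apply Cmod_ge_0|exact HB].
Qed.

Lemma derive_0_constant_on_H (F : C -> C) (z0 z1 : C) :
  (forall z, upper_half_plane z -> C_derive_at F z (RtoC 0)) ->
  upper_half_plane z0 -> upper_half_plane z1 -> F z0 = F z1.
Proof.
  intros HF H0 H1.
  assert (HE : Cmod (F (seg z0 z1 1) - F (seg z0 z1 0)) <= 0 * (1 - 0)).
  { apply (path_mean_value (fun t => F (seg z0 z1 t)) (fun _ => (RtoC 0 * (z1 - z0))%C)); [lra|].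
    intros t Ht. split.
    - apply C_derive_at_comp_path; [|apply path_derive_seg]. apply HF. now apply seg_upper.
    - replace (RtoC 0 * (z1 - z0))%C with (RtoC 0) by ring. rewrite Cmod_0. lra. }
  assert (E : (F (seg z0 z1 1) - F (seg z0 z1 0))%C = RtoC 0).
  { apply Cmod_eq_0. apply Rle_antisym; [lra|apply Cmod_ge_0]. }
  replace (seg z0 z1 1) with z1 in E by (unfold seg; ring).
  replace (seg z0 z1 0) with z0 in E by (unfold seg; ring).
  transitivity (F z1 - (F z1 - F z0))%C; [ring|rewrite E; ring].
Qed.

(** * Moebius transformations *)

Definition den (A : mat2) (z : C) : C := (RtoC (IZR (mc A)) * z + RtoC (IZR (md A)))%C.

Lemma SL2Z_det_R (A : mat2) :
  SL2Z A -> IZR (ma A) * IZR (md A) - IZR (mb A) * IZR (mc A) = 1.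
Proof.
  unfold SL2Z, mat2_det. intros H. rewrite <- !mult_IZR, <- minus_IZR, H. reflexivity.
Qed.

Lemma den_neq_0 (A : mat2) (z : C) : SL2Z A -> upper_half_plane z -> den A z <> RtoC 0.
Proof.
  intros HA%SL2Z_det_R Hz E. unfold upper_half_plane in Hz.
  assert (E2 : IZR (mc A) * Im z = 0).
  { apply (f_equal Im) in E. unfold den, Im in *. simpl in E. lra. }
  assert (Hc : IZR (mc A) = 0) by (apply Rmult_integral in E2; lra).
  assert (Hd : IZR (md A) = 0).
  { apply (f_equal Re) in E. unfold den, Re, Im in *. simpl in E. rewrite Hc in E. lra. }
  rewrite Hc, Hd in HA. lra.
Qed.

Lemma moebC_upper (A : mat2) (z : C) :
  SL2Z A -> upper_half_plane z -> upper_half_plane (moebC A z).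
Proof.
  intros HA Hz. pose proof (den_neq_0 A z HA Hz) as Hd. apply SL2Z_det_R in HA.
  assert (Hn : 0 < Cmod (den A z) ^ 2) by (apply pow_lt; now apply Cmod_gt_0).
  rewrite Cmod2_alt in Hn.
  unfold upper_half_plane in *.
  replace (Im (moebC A z)) with (Im z / (Re (den A z) ^ 2 + Im (den A z) ^ 2)).
  - now apply Rdiv_lt_0_compat.
  - unfold moebC. fold (den A z). set (N := den A z) in *.
    transitivity ((IZR (ma A) * IZR (md A) - IZR (mb A) * IZR (mc A)) * Im z / (Re N ^ 2 + Im N ^ 2)).
    { rewrite HA. unfold Rdiv. ring. }
    assert (E1 : Re N = IZR (mc A) * Re z + IZR (md A)) by (unfold N, den, Re; simpl; ring).
    assert (E2 : Im N = IZR (mc A) * Im z) by (unfold N, den, Im; simpl; ring).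
    transitivity (((IZR (ma A) * Im z) * Re N - (IZR (ma A) * Re z + IZR (mb A)) * Im N)
                  / (Re N ^ 2 + Im N ^ 2)).
    { f_equal. rewrite E1, E2. ring. }
    unfold Re, Im in *. simpl. field. simpl in Hn. lra.
Qed.

Lemma SL2Z_mul (A B : mat2) : SL2Z A -> SL2Z B -> SL2Z (mat2_mul A B).
Proof.
  unfold SL2Z, mat2_det, mat2_mul. simpl. intros HA HB.
  transitivity ((ma A * md A - mb A * mc A) * (ma B * md B - mb B * mc B))%Z; [ring|].
  rewrite HA, HB. reflexivity.
Qed.

Lemma moebC_mul (A B : mat2) (z : C) :
  SL2Z A -> SL2Z B -> upper_half_plane z ->
  moebC (mat2_mul A B) z = moebC A (moebC B z).
Proof.
  intros HA HB Hz.
  pose proof (den_neq_0 _ _ HB Hz) as H1.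
  pose proof (den_neq_0 _ _ HA (moebC_upper _ _ HB Hz)) as H2.
  pose proof (den_neq_0 _ _ (SL2Z_mul _ _ HA HB) Hz) as H3.
  unfold moebC, den, mat2_mul in *. simpl in *.
  rewrite !plus_IZR, !mult_IZR, !RtoC_plus, !RtoC_mult in *.
  field. repeat split; try assumption; intros E; apply H3; rewrite <- E; ring.
Qed.

Lemma C_derive_at_moebC (A : mat2) (z : C) :
  SL2Z A -> upper_half_plane z -> C_derive_at (moebC A) z (/ (den A z * den A z))%C.
Proof.
  intros HA Hz. pose proof (den_neq_0 _ _ HA Hz) as Hd. apply SL2Z_det_R in HA.
  assert (Haff : forall a b : R, C_derive_at (fun y => RtoC a * y + RtoC b)%C z (RtoC a)).
  { intros a b. refine (C_derive_at_ext _ _ _ _ _ (fun _ => eq_refl) _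
      (C_derive_at_plus _ _ _ _ _ (C_derive_at_mult _ _ _ _ _ (C_derive_at_const (RtoC a) z)
        (C_derive_at_id z)) (C_derive_at_const (RtoC b) z))). ring. }
  pose proof (C_derive_at_comp _ (den A) z _ _ (C_derive_at_inv _ Hd)
    (Haff (IZR (mc A)) (IZR (md A)))) as Hinv.
  refine (C_derive_at_ext _ _ _ _ _ (fun _ => eq_refl) _
    (C_derive_at_mult _ _ _ _ _ (Haff (IZR (ma A)) (IZR (mb A))) Hinv)).
  transitivity (RtoC (IZR (ma A) * IZR (md A) - IZR (mb A) * IZR (mc A)) / (den A z * den A z))%C.
  - rewrite RtoC_minus, !RtoC_mult. unfold den in *. field. exact Hd.
  - rewrite HA. unfold Cdiv. ring.
Qed.

(** * The invariant differential forms *)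

(** The coefficient of dtau in the form omega (w, w'). *)
Definition kern (w w' : R) (z : C) : C := (/ (z - RtoC w) - / (z - RtoC w'))%C.

Lemma upper_minus_real_neq_0 (z : C) (w : R) : upper_half_plane z -> (z - RtoC w)%C <> RtoC 0.
Proof.
  intros Hz E. apply (f_equal Im) in E. unfold upper_half_plane, Im in *. simpl in E. lra.
Qed.

Lemma kern_holomorphic (w w' : R) : holomorphic_on_H (kern w w').
Proof.
  assert (H : forall (u : R) (z : C), upper_half_plane z ->
    exists l, C_derive_at (fun y => / (y - RtoC u))%C z l).
  { intros u z Hz. eexists.
    apply (C_derive_at_comp Cinv (fun y => y - RtoC u)%C).
    - apply C_derive_at_inv. now apply upper_minus_real_neq_0.
    - apply (C_derive_at_minus (fun y => y)); [apply C_derive_at_id|apply C_derive_at_const]. }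
  intros z Hz. destruct (H w z Hz) as [l Hl]. destruct (H w' z Hz) as [l' Hl'].
  exists (l - l')%C. now apply C_derive_at_minus.
Qed.

Lemma mult_holomorphic (f g : C -> C) :
  holomorphic_on_H f -> holomorphic_on_H g -> holomorphic_on_H (fun z => f z * g z)%C.
Proof.
  intros Hf Hg z Hz. destruct (Hf z Hz) as [a Ha]. destruct (Hg z Hz) as [b Hb].
  exists (a * g z + f z * b)%C. now apply C_derive_at_mult.
Qed.

(** Equivariance of omega. Since A z - A v = (z - v) / ((c z + d) (c v + d)), the difference of
    reciprocals has numerator (c u + d) (z - u') - (c u' + d) (z - u) = (u - u') (c z + d), up to
    the factor c z + d. *)
Lemma kern_moeb (A : mat2) (u u' : R) (z : C) :
  SL2Z A -> upper_half_plane z ->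
  IZR (mc A) * u + IZR (md A) <> 0 -> IZR (mc A) * u' + IZR (md A) <> 0 ->
  (kern (moebR A u) (moebR A u') (moebC A z) / (den A z * den A z))%C = kern u u' z.
Proof.
  intros HA Hz Hu Hu'. pose proof (den_neq_0 _ _ HA Hz) as Hd.
  pose proof (moebC_upper _ _ HA Hz) as HAz. apply SL2Z_det_R in HA.
  assert (Hdiff : forall v, IZR (mc A) * v + IZR (md A) <> 0 ->
    (moebC A z - RtoC (moebR A v))%C = ((z - RtoC v) / (den A z * RtoC (IZR (mc A) * v + IZR (md A))))%C).
  { intros v Hv. unfold moebR. rewrite RtoC_div by exact Hv.
    assert (Hv' : RtoC (IZR (mc A) * v + IZR (md A)) <> RtoC 0) by (intros E; apply RtoC_inj in E; auto).
    transitivity (RtoC (IZR (ma A) * IZR (md A) - IZR (mb A) * IZR (mc A)) * (z - RtoC v)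
       / (den A z * RtoC (IZR (mc A) * v + IZR (md A))))%C.
    - unfold moebC, den in *. rewrite RtoC_minus, !RtoC_plus, !RtoC_mult in *. field. split; assumption.
    - rewrite HA. f_equal. ring. }
  unfold kern. rewrite !Hdiff by assumption.
  pose proof (upper_minus_real_neq_0 z u Hz) as Z1. pose proof (upper_minus_real_neq_0 z u' Hz) as Z2.
  assert (N1 : RtoC (IZR (mc A) * u + IZR (md A)) <> RtoC 0) by (intros E; apply RtoC_inj in E; auto).
  assert (N2 : RtoC (IZR (mc A) * u' + IZR (md A)) <> RtoC 0) by (intros E; apply RtoC_inj in E; auto).
  assert (E : (/ ((z - u) / (den A z * RtoC (IZR (mc A) * u + IZR (md A)))) -
     / ((z - u') / (den A z * RtoC (IZR (mc A) * u' + IZR (md A)))))%C =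
     (den A z * (den A z * (u - u')) / ((z - u) * (z - u')))%C).
  { unfold den in *. rewrite !RtoC_plus, !RtoC_mult in *. field. repeat split; assumption. }
  rewrite E. field. repeat split; assumption.
Qed.

Definition primitive_on_H (f G : C -> C) (w w' : R) : Prop :=
  forall z, upper_half_plane z -> C_derive_at G z (f z * kern w w' z)%C.

Lemma primitive_exists (f : C -> C) (w w' : R) :
  holomorphic_on_H f -> exists G, primitive_on_H f G w w'.
Proof.
  intros Hf. apply holomorphic_primitive, mult_holomorphic; [exact Hf|apply kern_holomorphic].
Qed.

Lemma primitive_moeb (f G : C -> C) (A : mat2) (u u' : R) :
  weakly_holomorphic_modular f -> SL2Z A ->
  IZR (mc A) * u + IZR (md A) <> 0 -> IZR (mc A) * u' + IZR (md A) <> 0 ->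
  primitive_on_H f G (moebR A u) (moebR A u') ->
  primitive_on_H f (fun z => G (moebC A z)) u u'.
Proof.
  intros Hf HA Hu Hu' HG z Hz.
  refine (C_derive_at_ext _ _ _ _ _ (fun _ => eq_refl) _
    (C_derive_at_comp _ _ _ _ _ (HG _ (moebC_upper _ _ HA Hz)) (C_derive_at_moebC _ _ HA Hz))).
  rewrite (whm_invariant f Hf A z HA Hz), <- (kern_moeb A u u' z HA Hz Hu Hu').
  unfold Cdiv. ring.
Qed.

Lemma primitive_unique (f G1 G2 : C -> C) (w w' : R) (z0 z1 : C) :
  primitive_on_H f G1 w w' -> primitive_on_H f G2 w w' ->
  upper_half_plane z0 -> upper_half_plane z1 ->
  (G1 z1 - G1 z0 = G2 z1 - G2 z0)%C.
Proof.
  intros H1 H2 Hz0 Hz1.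
  assert (E : (G1 z0 - G2 z0 = G1 z1 - G2 z1)%C).
  { apply (derive_0_constant_on_H (fun z => G1 z - G2 z)%C); try assumption.
    intros z Hz. refine (C_derive_at_ext _ _ _ _ _ (fun _ => eq_refl) _
      (C_derive_at_minus _ _ _ _ _ (H1 z Hz) (H2 z Hz))). ring. }
  transitivity (G1 z1 - (G1 z0 - G2 z0) - G2 z0)%C; [ring|]. rewrite E. ring.
Qed.

(** As A fixes both poles, G and its composite with A are primitives of the same form and differ by
    a constant. This is the independence of the base point. *)
Lemma primitive_period (f G : C -> C) (A : mat2) (w w' : R) (z0 z1 : C) :
  weakly_holomorphic_modular f -> SL2Z A -> fixed_point A w -> fixed_point A w' ->
  primitive_on_H f G w w' -> upper_half_plane z0 -> upper_half_plane z1 ->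
  (G (moebC A z0) - G z0 = G (moebC A z1) - G z1)%C.
Proof.
  intros Hf HA [Hd E] [Hd' E'] HG Hz0 Hz1.
  assert (HGA : primitive_on_H f (fun z => G (moebC A z)) w w').
  { apply primitive_moeb; try assumption. now rewrite E, E'. }
  pose proof (primitive_unique f _ _ w w' z0 z1 HGA HG Hz0 Hz1) as P.
  transitivity (G (moebC A z0) + (G z1 - G z0) - G z1)%C; [ring|]. rewrite <- P. ring.
Qed.

Lemma segment_integral_form (f G : C -> C) (w w' : R) (z0 z1 : C) :
  holomorphic_on_H f -> primitive_on_H f G w w' -> upper_half_plane z0 -> upper_half_plane z1 ->
  segment_integral (fun z => f z * kern w w' z)%C z0 z1 = (G z1 - G z0)%C.
Proof.
  intros Hf HG H0 H1. apply segment_integral_primitive; intros t Ht.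
  - apply (mult_holomorphic f (kern w w') Hf (kern_holomorphic w w')). now apply seg_upper.
  - apply HG. now apply seg_upper.
Qed.

(** * Fixed points and the quadratic form *)

Lemma fixed_point_root (A : mat2) (w : R) :
  fixed_point A w <->
  IZR (mc A) * w + IZR (md A) <> 0 /\
  IZR (mc A) * w * w + (IZR (md A) - IZR (ma A)) * w - IZR (mb A) = 0.
Proof.
  unfold fixed_point, moebR. split; intros [H E]; split; try exact H.
  - apply (f_equal (fun t => t * (IZR (mc A) * w + IZR (md A)))) in E.
    replace ((IZR (ma A) * w + IZR (mb A)) / (IZR (mc A) * w + IZR (md A)) * (IZR (mc A) * w + IZR (md A)))
      with (IZR (ma A) * w + IZR (mb A)) in E by (field; exact H). lra.
  - apply Rmult_eq_reg_r with (IZR (mc A) * w + IZR (md A)); [|exact H].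
    transitivity (IZR (ma A) * w + IZR (mb A)); [field; exact H|lra].
Qed.

Lemma Derive_moebR (A : mat2) (w : R) :
  SL2Z A -> IZR (mc A) * w + IZR (md A) <> 0 ->
  Derive (moebR A) w = / ((IZR (mc A) * w + IZR (md A)) * (IZR (mc A) * w + IZR (md A))).
Proof.
  intros HA%SL2Z_det_R H. apply is_derive_unique. unfold moebR. auto_derive; [exact H|].
  transitivity ((IZR (ma A) * IZR (md A) - IZR (mb A) * IZR (mc A))
    / ((IZR (mc A) * w + IZR (md A)) * (IZR (mc A) * w + IZR (md A)))); [field; exact H|].
  rewrite HA. unfold Rdiv. ring.
Qed.

(** The two factors are the eigenvalues of A: c w + d belongs to the eigenvector (w, 1), a - c w is
    the trace minus it, and the determinant is 1. *)
Lemma multiplier_eq (A : mat2) (w : R) :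
  SL2Z A -> fixed_point A w ->
  (IZR (mc A) * w + IZR (md A)) * (IZR (ma A) - IZR (mc A) * w) = 1.
Proof.
  intros HA%SL2Z_det_R [_ E]%fixed_point_root. rewrite <- HA.
  transitivity (IZR (ma A) * IZR (md A) - IZR (mc A) *
    (IZR (mc A) * w * w + (IZR (md A) - IZR (ma A)) * w)); [ring|].
  replace (IZR (mc A) * w * w + (IZR (md A) - IZR (ma A)) * w) with (IZR (mb A)) by lra. ring.
Qed.

Lemma SL2Z_nonneg_diag (A : mat2) : SL2Z_nonneg A -> 1 <= IZR (ma A) /\ 1 <= IZR (md A).
Proof.
  intros (HA & Ha & Hb & Hc & Hd). unfold SL2Z, mat2_det in HA.
  assert (0 <= mb A * mc A)%Z by now apply Z.mul_nonneg_nonneg.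
  assert (ma A <> 0 /\ md A <> 0)%Z as [].
  { split; intros E; rewrite E in HA; lia. }
  split; apply IZR_le; lia.
Qed.

Lemma SL2Z_nonneg_hyperbolic (A : mat2) :
  SL2Z_nonneg A -> hyperbolic A -> (0 < mb A /\ 0 < mc A)%Z.
Proof.
  intros (HA & Ha & Hb & Hc & Hd) Hh. unfold SL2Z, mat2_det in HA.
  unfold hyperbolic, mat2_trace in Hh.
  assert (mb A * mc A <> 0)%Z.
  { intros E. assert (H : (ma A * md A = 1)%Z) by lia. apply Z.eq_mul_1_nonneg in H; lia. }
  nia.
Qed.

(** Attraction means |c w + d| > 1. If w <= 0, the other eigenvalue a - c w is at least 1, which
    forces 0 < c w + d <= 1. *)
Lemma attracting_pos (A : mat2) (w : R) :
  SL2Z_nonneg A -> attracting_fixed_point A w -> 0 < w.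
Proof.
  intros HA [Hw Hd]. destruct (SL2Z_nonneg_diag A HA) as [Ha1 Hd1].
  destruct HA as (HS & _ & _ & Hc & _). apply IZR_le in Hc.
  pose proof (multiplier_eq A w HS Hw) as E.
  rewrite Derive_moebR in Hd by (try assumption; apply Hw).
  destruct Hw as [Hl _]. set (l := IZR (mc A) * w + IZR (md A)) in *.
  assert (Hll : 0 < l * l) by nra.
  rewrite Rabs_pos_eq in Hd by (apply Rlt_le, Rinv_0_lt_compat; exact Hll).
  assert (Hl1 : 1 < l * l).
  { rewrite <- Rinv_1 in Hd. apply Rinv_lt_cancel in Hd; lra. }
  apply Rnot_le_lt. intros Hw0.
  assert (H1 : 1 <= IZR (ma A) - IZR (mc A) * w) by nra.
  assert (0 < l) by nra. assert (l <= 1) by nra. nra.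
Qed.

Lemma repelling_neg (A : mat2) (w : R) :
  SL2Z_nonneg A -> repelling_fixed_point A w -> w < 0.
Proof.
  intros HA [Hw Hd]. destruct (SL2Z_nonneg_diag A HA) as [Ha1 Hd1].
  destruct HA as (HS & _ & _ & Hc & _). apply IZR_le in Hc.
  rewrite Derive_moebR in Hd by (try assumption; apply Hw).
  destruct Hw as [Hl _]. set (l := IZR (mc A) * w + IZR (md A)) in *.
  assert (Hll : 0 < l * l) by nra.
  rewrite Rabs_pos_eq in Hd by (apply Rlt_le, Rinv_0_lt_compat; exact Hll).
  assert (Hl1 : l * l < 1).
  { rewrite <- Rinv_1 in Hd. apply Rinv_lt_cancel in Hd; lra. }
  apply Rnot_le_lt. intros Hw0. assert (1 <= l) by (unfold l; nra). nra.
Qed.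

Lemma qform_eval_RtoC (q : qform) (w : R) :
  qform_eval q (RtoC w) (RtoC 1) = RtoC (IZR (qa q) * w * w + IZR (qb q) * w + IZR (qc q)).
Proof. unfold qform_eval. rewrite !RtoC_plus, !RtoC_mult. ring. Qed.

Lemma gcd3_div (a b c : Z) :
  (0 < a)%Z -> let g := Z.gcd (Z.gcd a b) c in
  (0 < g /\ (g | a) /\ (g | b) /\ (g | c) /\
   Z.gcd (Z.gcd (a / g) (b / g)) (c / g) = 1)%Z.
Proof.
  intros Ha g.
  assert (Hga : (g | a)%Z) by (eapply Z.divide_trans; [apply Z.gcd_divide_l|apply Z.gcd_divide_l]).
  assert (Hgb : (g | b)%Z) by (eapply Z.divide_trans; [apply Z.gcd_divide_l|apply Z.gcd_divide_r]).
  assert (Hgc : (g | c)%Z) by apply Z.gcd_divide_r.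
  assert (Hg : (0 < g)%Z).
  { assert (0 <= g)%Z by apply Z.gcd_nonneg. assert (g <> 0)%Z; [|lia].
    intros E. rewrite E in Hga. apply Z.divide_0_l in Hga. lia. }
  repeat (split; [assumption|]).
  rewrite (Z.gcd_div_factor a b g Hg Hga Hgb), Z.gcd_div_factor; try assumption.
  - fold g. apply Z.div_same. lia.
  - apply Z.gcd_divide_l.
Qed.

Lemma hyperbolic_fixed_points (A : mat2) :
  SL2Z_nonneg A -> hyperbolic A ->
  exists w w', w < w' /\ repelling_fixed_point A w /\ attracting_fixed_point A w'.
Proof.
  intros HA Hh. destruct (SL2Z_nonneg_hyperbolic A HA Hh) as [Hb Hc].
  apply IZR_lt in Hb. apply IZR_lt in Hc.
  destruct (SL2Z_nonneg_diag A HA) as [Ha1 Hd1]. destruct HA as (HS & _).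
  pose proof (SL2Z_det_R A HS) as HD.
  set (a := IZR (ma A)) in *. set (b := IZR (mb A)) in *.
  set (c := IZR (mc A)) in *. set (d := IZR (md A)) in *.
  set (s := sqrt ((a + d) * (a + d) - 4)).
  assert (Hss : s * s = (a + d) * (a + d) - 4) by (apply sqrt_sqrt; nra).
  assert (Hs0 : 0 <= s) by apply sqrt_pos.
  assert (Hs : 0 < s) by nra.
  assert (Hst : s < a + d) by nra.
  (* [e] is [s] or [- s], and [l] is the eigenvalue at the corresponding root; it is below 1 for
     [- s] and above 1 for [s]. *)
  assert (Hroot : forall e, e * e = s * s -> let w := (a - d + e) / (2 * c) in
    let l := (a + d + e) / 2 in
    l <> 0 -> fixed_point A w /\ Derive (moebR A) w = / (l * l)).
  { intros e He w l Hl0.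
    assert (Hl : c * w + d = l) by (unfold w, l; field; lra).
    assert (Hf : fixed_point A w).
    { apply fixed_point_root. fold a b c d. split; [rewrite Hl; exact Hl0|].
      assert (E : c * w * w + (d - a) * w - b = (e * e - (s * s)) / (4 * c)).
      { rewrite Hss. replace 4 with (4 * (a * d - b * c)) at 1 by (rewrite HD; ring).
        unfold w. field. lra. }
      rewrite E, He. unfold Rdiv. ring. }
    split; [exact Hf|]. rewrite Derive_moebR by (try assumption; apply Hf).
    fold c d. rewrite Hl. reflexivity. }
  destruct (Hroot (- s) ltac:(ring) ltac:(lra)) as [F1 D1].
  destruct (Hroot s ltac:(ring) ltac:(lra)) as [F2 D2].
  exists ((a - d + - s) / (2 * c)), ((a - d + s) / (2 * c)). split; [|split].
  - apply Rmult_lt_compat_r; [apply Rinv_0_lt_compat; lra|lra].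
  - split; [exact F1|]. rewrite D1.
    assert (Hl : 0 < (a + d + - s) / 2 * ((a + d + - s) / 2)) by nra.
    rewrite Rabs_pos_eq by (apply Rlt_le, Rinv_0_lt_compat; exact Hl).
    rewrite <- Rinv_1. apply Rinv_lt_contravar; [lra|].
    assert (a + d - s < 2) by nra. nra.
  - split; [exact F2|]. rewrite D2.
    assert (Hl : 0 < (a + d + s) / 2 * ((a + d + s) / 2)) by nra.
    rewrite Rabs_pos_eq by (apply Rlt_le, Rinv_0_lt_compat; exact Hl).
    rewrite <- Rinv_1. apply Rinv_lt_contravar; [lra|].
    assert (2 < a + d) by nra. nra.
Qed.

Lemma cycle_form_exists (A : mat2) :
  SL2Z_nonneg A -> hyperbolic A -> exists q, is_cycle_form A q.
Proof.
  intros HA Hh. destruct (hyperbolic_fixed_points A HA Hh) as (w & w' & Hlt & Hw & Hw').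
  destruct (SL2Z_nonneg_hyperbolic A HA Hh) as [_ Hc].
  destruct (gcd3_div (mc A) (md A - ma A) (- mb A) Hc) as (Hg & (x & Hx) & (y & Hy) & (z & Hz) & Hp).
  set (g := Z.gcd (Z.gcd (mc A) (md A - ma A)) (- mb A)) in *.
  rewrite Hx, Hy, Hz, !Z.div_mul in Hp by lia.
  assert (Hroot : forall u, fixed_point A u ->
    IZR (- x) * u * u + IZR (- y) * u + IZR (- z) = 0).
  { intros u [_ Hu]%fixed_point_root. apply IZR_lt in Hg.
    apply (f_equal IZR) in Hx, Hy, Hz.
    rewrite mult_IZR in Hx, Hy, Hz. rewrite minus_IZR in Hy. rewrite opp_IZR in Hz.
    rewrite !opp_IZR. apply Rmult_eq_reg_r with (IZR g); [|lra].
    rewrite Rmult_0_l. rewrite <- Ropp_0, <- Hu, Hx, Hy.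
    replace (IZR (mb A)) with (- (IZR z * IZR g)) by lra. ring. }
  (* The fixed-point equation divided by its content. The sign is reversed because [mc A] is
     positive while w < w' demands a negative leading coefficient. *)
  exists (QForm (- x) (- y) (- z)), w, w'.
  repeat (split; [assumption|]). split; [|split; [|split]].
  - unfold qform_primitive. simpl. now rewrite Z.gcd_opp_l, !Z.gcd_opp_r.
  - rewrite qform_eval_RtoC. simpl. f_equal. apply Hroot, Hw.
  - rewrite qform_eval_RtoC. simpl. f_equal. apply Hroot, Hw'.
  - simpl. rewrite !sign_eq_m1; try lra. apply IZR_lt. nia.
Qed.

(** The sign convention gives sqrt D = a (w - w') without absolute value, so the leading coefficient
    cancels against Q = a (z - w) (z - w'). The points w, w' are those attached to the form chosen
    by [epsilon]. *)
Lemma cycle_form_kern (A : mat2) :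
  SL2Z_nonneg A -> hyperbolic A ->
  exists w w', repelling_fixed_point A w /\ attracting_fixed_point A w' /\
    forall z, upper_half_plane z ->
      (RtoC (sqrt (IZR (qform_disc (cycle_form A)))) / qform_eval (cycle_form A) z (RtoC 1))%C
      = kern w w' z.
Proof.
  intros HA Hh.
  pose proof (epsilon_spec (inhabits (QForm 0 0 0)) (is_cycle_form A) (cycle_form_exists A HA Hh)) as Hq.
  fold (cycle_form A) in Hq. set (q := cycle_form A) in *.
  destruct Hq as (w & w' & Hw & Hw' & Hp & E & E' & Hs).
  exists w, w'. split; [exact Hw|]. split; [exact Hw'|]. intros z Hz.
  pose proof (repelling_neg A w HA Hw). pose proof (attracting_pos A w' HA Hw').
  rewrite qform_eval_RtoC in E, E'. apply RtoC_inj in E, E'.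
  rewrite (sign_eq_m1 (w - w')) in Hs by lra.
  assert (Ha : IZR (qa q) < 0).
  { destruct (Rtotal_order (IZR (qa q)) 0) as [H1|[H1|H1]]; [exact H1| |].
    - rewrite H1, sign_0 in Hs. lra.
    - rewrite sign_eq_1 in Hs; lra. }
  assert (Eb : IZR (qb q) = - IZR (qa q) * (w + w')).
  { apply Rmult_eq_reg_r with (w - w'); [|lra].
    transitivity (- IZR (qa q) * w * w + IZR (qa q) * w' * w'
      + (IZR (qa q) * w * w + IZR (qb q) * w + IZR (qc q))
      - (IZR (qa q) * w' * w' + IZR (qb q) * w' + IZR (qc q))); [ring|].
    rewrite E, E'. ring. }
  assert (Ec : IZR (qc q) = IZR (qa q) * (w * w')) by (rewrite Eb in E; nra).
  assert (ED : sqrt (IZR (qform_disc q)) = IZR (qa q) * (w - w')).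
  { replace (IZR (qform_disc q)) with (Rsqr (IZR (qa q) * (w - w'))).
    - apply sqrt_Rsqr. nra.
    - unfold qform_disc. rewrite minus_IZR, !mult_IZR, Eb, Ec. unfold Rsqr. ring. }
  assert (EQ : qform_eval q z (RtoC 1) = (RtoC (IZR (qa q)) * ((z - w) * (z - w')))%C).
  { unfold qform_eval. rewrite Eb, Ec, !RtoC_mult, RtoC_opp, RtoC_plus. ring. }
  rewrite ED, EQ, RtoC_mult, RtoC_minus. unfold kern.
  pose proof (upper_minus_real_neq_0 z w Hz). pose proof (upper_minus_real_neq_0 z w' Hz).
  assert (RtoC (IZR (qa q)) <> RtoC 0) by (intros F; apply RtoC_inj in F; lra).
  field. repeat split; assumption.
Qed.

Lemma segment_integral_ext (g1 g2 : C -> C) (z0 z1 : C) :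
  (forall t, 0 <= t <= 1 -> g1 (seg z0 z1 t) = g2 (seg z0 z1 t)) ->
  segment_integral g1 z0 z1 = segment_integral g2 z0 z1.
Proof.
  intros H. apply (RInt_ext (V := C_R_CompleteNormedModule)). intros t Ht.
  rewrite Rmin_left, Rmax_right in Ht by lra.
  specialize (H t ltac:(lra)). unfold seg in H. now rewrite H.
Qed.

(** Moves the base point from the given [tau0] to any [tau1]; it is applied with [tau1] equal to
    [rho], where the path splits along the word. *)
Lemma cycle_integral_primitive (f : C -> C) (tau0 tau1 : C) (A : mat2) :
  weakly_holomorphic_modular f -> upper_half_plane tau0 -> upper_half_plane tau1 ->
  SL2Z_nonneg A -> hyperbolic A -> forall w w' G,
  repelling_fixed_point A w -> attracting_fixed_point A w' ->
  (forall z, upper_half_plane z ->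
      (RtoC (sqrt (IZR (qform_disc (cycle_form A)))) / qform_eval (cycle_form A) z (RtoC 1))%C
      = kern w w' z) ->
  primitive_on_H f G w w' ->
  cycle_integral f tau0 A = (G (moebC A tau1) - G tau1)%C.
Proof.
  intros Hf H0 H1 HA Hh w w' G Hw Hw' HK HG.
  assert (HS : SL2Z A) by apply HA.
  rewrite <- (primitive_period f G A w w' tau0 tau1 Hf HS (proj1 Hw) (proj1 Hw') HG H0 H1).
  unfold cycle_integral. destruct (hyperbolic_dec A) as [_|n]; [|contradiction].
  pose proof (moebC_upper A tau0 HS H0) as HA0.
  rewrite <- (segment_integral_form f G w w') by first [assumption | exact (whm_holomorphic f Hf)].
  apply segment_integral_ext. intros t Ht. rewrite <- HK by now apply seg_upper.
  unfold Cdiv. ring.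
Qed.

(** * Words in T and V *)

(* Words over T and V are encoded as lists of booleans, [true] standing for T. *)
Definition letter_mat (b : bool) : mat2 := if b then matT else matV.

Definition word_mat (W : list bool) : mat2 :=
  fold_right (fun b => mat2_mul (letter_mat b)) mat2_one W.

Definition step (b : bool) (y : R) : R := if b then y + 1 else y / (y + 1).

Definition act (W : list bool) (y : R) : R := fold_right step y W.

(* The inverse of a letter maps [- v] to [- step b v]; reading a word from the
   left therefore moves the repelling fixed point by the same two maps. *)
Definition pass (W : list bool) (v : R) : R := fold_left (fun v b => step b v) W v.

Lemma step_pos (b : bool) (y : R) : 0 < y -> 0 < step b y.
Proof. destruct b; simpl; intros H; [lra|]. apply Rdiv_lt_0_compat; lra. Qed.

Lemma act_pos (W : list bool) (y : R) : 0 < y -> 0 < act W y.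
Proof. intros H. induction W; [exact H|]. now apply step_pos. Qed.

Lemma pass_pos (W : list bool) (v : R) : 0 < v -> 0 < pass W v.
Proof. revert v. induction W as [|b W IH]; intros v H; [exact H|]. simpl. apply IH, step_pos, H. Qed.

Lemma act_app (W1 W2 : list bool) (y : R) : act (W1 ++ W2) y = act W1 (act W2 y).
Proof. apply fold_right_app. Qed.

Lemma letter_mat_SL2Z (b : bool) : SL2Z (letter_mat b).
Proof. destruct b; reflexivity. Qed.

Lemma SL2Z_nonneg_mul (A B : mat2) : SL2Z_nonneg A -> SL2Z_nonneg B -> SL2Z_nonneg (mat2_mul A B).
Proof.
  intros (HA & A1 & A2 & A3 & A4) (HB & B1 & B2 & B3 & B4).
  split; [now apply SL2Z_mul|]. simpl. repeat split; nia.
Qed.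

Lemma word_mat_nonneg (W : list bool) : SL2Z_nonneg (word_mat W).
Proof.
  induction W as [|b W IH].
  - repeat split; simpl; lia.
  - apply SL2Z_nonneg_mul; [|exact IH]. destruct b; repeat split; simpl; lia.
Qed.

Lemma mat2_mul_assoc (A B D : mat2) : mat2_mul A (mat2_mul B D) = mat2_mul (mat2_mul A B) D.
Proof. unfold mat2_mul. simpl. f_equal; ring. Qed.

Lemma mat2_mul_one_l (A : mat2) : mat2_mul mat2_one A = A.
Proof. destruct A as [a b c d]. unfold mat2_mul, mat2_one. cbn [ma mb mc md]. f_equal; ring. Qed.

Lemma word_mat_app (W1 W2 : list bool) : word_mat (W1 ++ W2) = mat2_mul (word_mat W1) (word_mat W2).
Proof.
  induction W1 as [|b W1 IH]; [symmetry; apply mat2_mul_one_l|].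
  change (mat2_mul (letter_mat b) (word_mat (W1 ++ W2)) =
    mat2_mul (mat2_mul (letter_mat b) (word_mat W1)) (word_mat W2)).
  rewrite IH. apply mat2_mul_assoc.
Qed.

Lemma nonneg_den_pos (A : mat2) (y : R) :
  SL2Z_nonneg A -> 0 < y -> 0 < IZR (mc A) * y + IZR (md A).
Proof.
  intros HA Hy. destruct (SL2Z_nonneg_diag A HA) as [_ Hd].
  destruct HA as (_ & _ & _ & Hc & _). apply IZR_le in Hc. nra.
Qed.

Lemma moebR_word_mat (W : list bool) (y : R) : 0 < y -> moebR (word_mat W) y = act W y.
Proof.
  intros Hy. induction W as [|b W IH].
  - unfold moebR. simpl. field.
  - change (act (b :: W) y) with (step b (act W y)). rewrite <- IH.
    pose proof (act_pos W y Hy) as Hp. rewrite <- IH in Hp.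
    pose proof (nonneg_den_pos _ y (word_mat_nonneg W) Hy) as Hd.
    change (word_mat (b :: W)) with (mat2_mul (letter_mat b) (word_mat W)).
    unfold moebR in *. set (B := word_mat W) in *.
    destruct b; cbn [letter_mat matT matV mat2_mul ma mb mc md step];
      rewrite !plus_IZR, !mult_IZR.
    + field. lra.
    + assert (Hn : 0 < IZR (ma B) * y + IZR (mb B)).
      { replace (IZR (ma B) * y + IZR (mb B)) with
          ((IZR (ma B) * y + IZR (mb B)) / (IZR (mc B) * y + IZR (md B)) * (IZR (mc B) * y + IZR (md B)))
          by (field; lra). now apply Rmult_lt_0_compat. }
      field. split; lra.
Qed.

(** Euclid's algorithm on the rows: subtracting the smaller row from the larger strips a letter on
    the left and lowers the sum of the entries. *)
Lemma nonneg_word (M : mat2) : SL2Z_nonneg M -> exists W, M = word_mat W.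
Proof.
  intros HM. remember (Z.to_nat (ma M + mb M + mc M + md M)) as k eqn:Hk.
  assert (Hk' : (Z.to_nat (ma M + mb M + mc M + md M) <= k)%nat) by lia. clear Hk.
  revert M HM Hk'. induction k as [|k IH]; intros M HM Hk.
  - exfalso. destruct HM as (H & Ha & Hb & Hc & Hd). unfold SL2Z, mat2_det in H.
    assert (ma M = 0 /\ mb M = 0)%Z as [E1 E2] by lia. rewrite E1, E2 in H. lia.
  - destruct M as [a b c d]. destruct HM as (H & Ha & Hb & Hc & Hd).
    unfold SL2Z, mat2_det in H. simpl in *.
    (* Rows that are not comparable have a > c and d > b, or both reversed. In the first case the
       determinant is at least b + c + 1, which leaves only the identity; in the second it is
       negative. *)
    assert (Hcase : ((a = 1 /\ b = 0 /\ c = 0 /\ d = 1) \/ (c <= a /\ d <= b)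
       \/ (a <= c /\ b <= d))%Z).
    { destruct (Z_le_gt_dec c a); destruct (Z_le_gt_dec d b);
      destruct (Z_le_gt_dec a c); destruct (Z_le_gt_dec b d); try nia; auto. }
    destruct Hcase as [(-> & -> & -> & ->)|[[H1 H2]|[H1 H2]]].
    + exists nil. reflexivity.
    + destruct (IH (Mat2 (a - c) (b - d) c d)) as [W HW].
      * unfold SL2Z_nonneg, SL2Z, mat2_det. cbn [ma mb mc md]. repeat split; try lia.
      * cbn [ma mb mc md]. assert (c + d <> 0)%Z; [|lia].
        intros E. assert (c = 0 /\ d = 0)%Z as [-> ->] by lia. lia.
      * exists (true :: W). simpl. rewrite <- HW. unfold mat2_mul, matT. cbn [ma mb mc md]. f_equal; ring.
    + destruct (IH (Mat2 a b (c - a) (d - b))) as [W HW].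
      * unfold SL2Z_nonneg, SL2Z, mat2_det. simpl. repeat split; try lia.
      * cbn [ma mb mc md]. assert (a + b <> 0)%Z; [|lia].
        intros E. assert (a = 0 /\ b = 0)%Z as [-> ->] by lia. lia.
      * exists (false :: W). simpl. rewrite <- HW. unfold mat2_mul, matV. cbn [ma mb mc md]. f_equal; ring.
Qed.

(** * The arc from exp(2 i pi/3) to exp(i pi/3) *)

Definition rho : C := cis (2 * PI / 3).
Definition rho' : C := cis (PI / 3).

Definition on_arc (t : R) : Prop := PI / 3 <= t <= 2 * PI / 3.

Lemma rho_eq : rho = (- (1 / 2), sqrt 3 / 2).
Proof.
  unfold rho, cis. replace (2 * PI / 3) with (2 * (PI / 3)) by field.
  rewrite cos_2PI3, sin_2PI3. f_equal; field.
Qed.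

Lemma rho'_eq : rho' = (1 / 2, sqrt 3 / 2).
Proof. unfold rho', cis. now rewrite cos_PI3, sin_PI3. Qed.

Lemma rho_upper : upper_half_plane rho.
Proof.
  rewrite rho_eq. unfold upper_half_plane. simpl. pose proof (sqrt_lt_R0 3). lra.
Qed.

Lemma rho'_upper : upper_half_plane rho'.
Proof.
  rewrite rho'_eq. unfold upper_half_plane. simpl. pose proof (sqrt_lt_R0 3). lra.
Qed.

(* Both letters send rho to rho + 1, so the path of a word runs through images
   of one and the same arc. *)
Lemma moebC_letter_rho (b : bool) : moebC (letter_mat b) rho = rho'.
Proof.
  assert (E1 : (rho + RtoC 1)%C = rho').
  { rewrite rho_eq, rho'_eq. apply injective_projections; simpl; lra. }
  assert (E2 : rho = (rho' * rho')%C).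
  { rewrite rho_eq, rho'_eq. assert (sqrt 3 * sqrt 3 = 3) by (apply sqrt_sqrt; lra).
    apply injective_projections; simpl; lra. }
  assert (H0 : rho' <> RtoC 0).
  { pose proof (upper_minus_real_neq_0 rho' 0 rho'_upper) as H. intros E. apply H. rewrite E. ring. }
  unfold moebC. destruct b; cbn [letter_mat matT matV ma mb mc md].
  - rewrite <- E1. field.
  - replace (RtoC 1 * rho + RtoC 1)%C with rho' by (rewrite <- E1; ring).
    rewrite E2. field. exact H0.
Qed.

Lemma path_derive_pair (x y : R -> R) (t a b : R) :
  is_derive x t a -> is_derive y t b -> path_derive (fun s => (x s, y s)) t (a, b).
Proof.
  intros [_ Hx] [_ Hy]. apply path_derive_iff. intros eps He.
  assert (He2 : 0 < eps / 2) by lra.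
  destruct (Hx t (fun P HP => HP) (mkposreal _ He2)) as [d1 H1].
  destruct (Hy t (fun P HP => HP) (mkposreal _ He2)) as [d2 H2].
  exists (Rmin d1 d2). split; [apply Rmin_glb_lt; apply cond_pos|].
  intros s Hs.
  specialize (H1 s (Rlt_le_trans _ _ _ Hs (Rmin_l _ _))).
  specialize (H2 s (Rlt_le_trans _ _ _ Hs (Rmin_r _ _))).
  change (Rabs (x s - x t - (s - t) * a) <= eps / 2 * Rabs (s - t)) in H1.
  change (Rabs (y s - y t - (s - t) * b) <= eps / 2 * Rabs (s - t)) in H2.
  eapply Rle_trans; [apply Cmod_le_Re_Im|]. unfold Re, Im. simpl.
  replace (x s + - x t + - ((s - t) * a - 0 * b)) with (x s - x t - (s - t) * a) by ring.
  replace (y s + - y t + - ((s - t) * b + 0 * a)) with (y s - y t - (s - t) * b) by ring.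
  lra.
Qed.

Lemma path_derive_cis (t : R) : path_derive cis t (- sin t, cos t).
Proof.
  apply path_derive_pair; apply is_derive_Reals; [apply derivable_pt_lim_cos|apply derivable_pt_lim_sin].
Qed.

Lemma Cmod_cis_derive (t : R) : Cmod (- sin t, cos t) = 1.
Proof.
  unfold Cmod. simpl. pose proof (sin2_cos2 t) as H. unfold Rsqr in H.
  replace (- sin t * (- sin t * 1) + cos t * (cos t * 1)) with 1 by lra. apply sqrt_1.
Qed.

Lemma cis_upper (t : R) : on_arc t -> upper_half_plane (cis t).
Proof.
  intros [H1 H2]. unfold upper_half_plane, cis. simpl. pose proof PI_RGT_0.
  apply sin_gt_0; lra.
Qed.

Lemma Rabs_cos_arc (t : R) : on_arc t -> Rabs (cos t) <= 1 / 2.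
Proof.
  intros [H1 H2]. pose proof PI_RGT_0. apply Rabs_le. split.
  - replace (- (1 / 2)) with (cos (2 * (PI / 3))) by (rewrite cos_2PI3; field).
    apply cos_decr_1; lra.
  - rewrite <- cos_PI3. apply cos_decr_1; lra.
Qed.

(** With m = |u|, |cos t| <= 1/2 gives |cis t - u|^2 >= 1 - m + m^2 = ((1 + m) / 2)^2 + 3 (1 - m)^2
    / 4. *)
Lemma Cmod_arc_minus_real (t u : R) :
  on_arc t -> (1 + Rabs u) / 2 <= Cmod (cis t - RtoC u).
Proof.
  intros Ht. pose proof (Rabs_cos_arc t Ht) as Hc. pose proof (Rabs_pos u) as Hu.
  apply Rsqr_incr_0_var; [|apply Cmod_ge_0].
  replace (Rsqr (Cmod (cis t - RtoC u))) with (Cmod (cis t - RtoC u) ^ 2) by (unfold Rsqr; ring).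
  rewrite Cmod2_alt. unfold cis, Re, Im, Rsqr. simpl.
  pose proof (sin2_cos2 t) as H. unfold Rsqr in H.
  assert (Huc : u * cos t <= Rabs u * (1 / 2)).
  { eapply Rle_trans; [apply Rle_abs|]. rewrite Rabs_mult. apply Rmult_le_compat_l; lra. }
  assert (Huu : u * u = Rabs u * Rabs u) by (rewrite <- Rabs_mult, Rabs_pos_eq; nra).
  apply Rle_trans with (1 - 2 * (u * cos t) + u * u).
  - rewrite Huu. set (m := Rabs u) in *. pose proof (Rle_0_sqr (1 - m)) as Hm. unfold Rsqr in Hm. lra.
  - right. transitivity ((sin t * sin t + cos t * cos t) - 2 * (u * cos t) + u * u); [rewrite H|]; ring.
Qed.

Lemma arc_constant_nonneg (S : R) : 0 <= S -> 0 <= S * (PI / 3) * 4.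
Proof. intros HS. pose proof PI_RGT_0. assert (0 <= S * (PI / 3)) by (apply Rmult_le_pos; lra). lra. Qed.

Lemma arc_mean_value (f F k : C -> C) (S D : R) :
  (forall t, on_arc t -> C_derive_at F (cis t) (f (cis t) * k (cis t))%C) ->
  (forall t, on_arc t -> Cmod (f (cis t)) <= S) ->
  (forall t, on_arc t -> Cmod (k (cis t)) <= D) ->
  Cmod (F rho' - F rho) <= S * (PI / 3) * D.
Proof.
  intros HF Hf Hk. pose proof PI_RGT_0.
  replace (F rho' - F rho)%C with (- (F rho - F rho'))%C by ring. rewrite Cmod_opp.
  replace (S * (PI / 3) * D) with (S * D * (2 * PI / 3 - PI / 3)) by field.
  apply (path_mean_value (fun t => F (cis t))
    (fun t => f (cis t) * k (cis t) * ((- sin t)%R, cos t))%C); [lra|].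
  intros t Ht. split.
  - apply C_derive_at_comp_path; [now apply HF|apply path_derive_cis].
  - rewrite !Cmod_mult, Cmod_cis_derive, Rmult_1_r.
    apply Rmult_le_compat; try apply Cmod_ge_0; auto.
Qed.

(** Written along the straight segment, but equal to the integral along the arc by means of a
    primitive; hence only values of f on the arc enter the bounds. *)
Definition arc_form (f : C -> C) (v z : R) : C :=
  segment_integral (fun tau => f tau * kern (- v) z tau)%C rho rho'.

Lemma arc_form_primitive (f G : C -> C) (v z : R) :
  holomorphic_on_H f -> primitive_on_H f G (- v) z -> arc_form f v z = (G rho' - G rho)%C.
Proof.
  intros Hf HG. apply segment_integral_form; auto using rho_upper, rho'_upper.
Qed.

(* Up to a constant, the chordal distance on the positive half of the projective line. *)
Definition chord (u v : R) : R := Rabs (u - v) / ((1 + u) * (1 + v)).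

Lemma Cmod_inv_arc_le (t u : R) : on_arc t -> Cmod (/ (cis t - RtoC u)) <= 2.
Proof.
  intros Ht. pose proof (Cmod_arc_minus_real t u Ht) as H. pose proof (Rabs_pos u).
  rewrite Cmod_inv by (apply Cmod_gt_0; lra).
  replace 2 with (/ (1 / 2)) by field. apply Rinv_le_contravar; lra.
Qed.

Lemma Cmod_inv_minus_arc_le (t u v : R) :
  on_arc t ->
  Cmod (/ (cis t - RtoC u) - / (cis t - RtoC v)) <= 4 * (Rabs (u - v) / ((1 + Rabs u) * (1 + Rabs v))).
Proof.
  intros Ht. pose proof (Cmod_arc_minus_real t u Ht) as Hu. pose proof (Rabs_pos u).
  pose proof (Cmod_arc_minus_real t v Ht) as Hv. pose proof (Rabs_pos v).
  assert (Nu : (cis t - RtoC u)%C <> RtoC 0) by (apply Cmod_gt_0; lra).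
  assert (Nv : (cis t - RtoC v)%C <> RtoC 0) by (apply Cmod_gt_0; lra).
  replace (/ (cis t - RtoC u) - / (cis t - RtoC v))%C
    with (RtoC (u - v) / ((cis t - RtoC u) * (cis t - RtoC v)))%C
    by (rewrite RtoC_minus; field; split; assumption).
  rewrite Cmod_div, Cmod_R, Cmod_mult by now apply Cmult_neq_0.
  replace (4 * (Rabs (u - v) / ((1 + Rabs u) * (1 + Rabs v))))
    with (Rabs (u - v) / ((1 + Rabs u) / 2 * ((1 + Rabs v) / 2))) by (field; lra).
  apply Rmult_le_compat_l; [apply Rabs_pos|]. apply Rinv_le_contravar; [nra|].
  apply Rmult_le_compat; lra.
Qed.

Lemma arc_form_bound (f : C -> C) (S v z : R) :
  holomorphic_on_H f -> (forall t, on_arc t -> Cmod (f (cis t)) <= S) ->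
  Cmod (arc_form f v z) <= S * (PI / 3) * 4.
Proof.
  intros Hf Hb. destruct (primitive_exists f (- v) z Hf) as [G HG].
  rewrite (arc_form_primitive f G) by assumption.
  apply (arc_mean_value f G (kern (- v) z)); try assumption.
  - intros t Ht. apply HG, cis_upper, Ht.
  - intros t Ht. unfold kern, Cminus. eapply Rle_trans; [apply Cmod_triangle|]. rewrite Cmod_opp.
    pose proof (Cmod_inv_arc_le t (- v) Ht). pose proof (Cmod_inv_arc_le t z Ht).
    unfold Cminus in *. lra.
Qed.

Lemma arc_form_diff_bound (f : C -> C) (S v z v1 z1 : R) :
  holomorphic_on_H f -> (forall t, on_arc t -> Cmod (f (cis t)) <= S) ->
  0 < v -> 0 < z -> 0 < v1 -> 0 < z1 ->
  Cmod (arc_form f v z - arc_form f v1 z1) <= S * (PI / 3) * (4 * (chord v v1 + chord z z1)).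
Proof.
  intros Hf Hb Hv Hz Hv1 Hz1.
  destruct (primitive_exists f (- v) z Hf) as [G HG].
  destruct (primitive_exists f (- v1) z1 Hf) as [G1 HG1].
  rewrite (arc_form_primitive f G), (arc_form_primitive f G1) by assumption.
  replace (G rho' - G rho - (G1 rho' - G1 rho))%C with ((G rho' - G1 rho') - (G rho - G1 rho))%C by ring.
  apply (arc_mean_value f (fun y => G y - G1 y)%C (fun y => kern (- v) z y - kern (- v1) z1 y)%C);
    try assumption.
  - intros t Ht. refine (C_derive_at_ext _ _ _ _ _ (fun _ => eq_refl) _
      (C_derive_at_minus _ _ _ _ _ (HG _ (cis_upper t Ht)) (HG1 _ (cis_upper t Ht)))). ring.
  - intros t Ht. unfold kern.
    replace (/ (cis t - RtoC (- v)) - / (cis t - RtoC z) - (/ (cis t - RtoC (- v1)) - / (cis t - RtoC z1)))%C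
      with ((/ (cis t - RtoC (- v)) - / (cis t - RtoC (- v1))) + - (/ (cis t - RtoC z) - / (cis t - RtoC z1)))%C
      by ring.
    eapply Rle_trans; [apply Cmod_triangle|]. rewrite Cmod_opp.
    pose proof (Cmod_inv_minus_arc_le t (- v) (- v1) Ht) as B1.
    pose proof (Cmod_inv_minus_arc_le t z z1 Ht) as B2.
    rewrite !Rabs_Ropp in B1. replace (- v - - v1) with (- (v - v1)) in B1 by ring.
    rewrite Rabs_Ropp in B1.
    rewrite (Rabs_pos_eq v), (Rabs_pos_eq v1) in B1 by lra.
    rewrite (Rabs_pos_eq z), (Rabs_pos_eq z1) in B2 by lra.
    unfold chord. lra.
Qed.

(** * Contraction of the logarithmic distance *)

Definition ln_dist (u v : R) : R := Rabs (ln u - ln v).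

Lemma ln_ge_1_minus_inv (y : R) : 0 < y -> 1 - / y <= ln y.
Proof.
  intros Hy. pose proof (exp_ineq1_le (ln (/ y))) as H.
  rewrite exp_ln in H by now apply Rinv_0_lt_compat.
  rewrite ln_Rinv in H by exact Hy. lra.
Qed.

(** For v <= u the drop is the logarithm of a quotient of ratios, and ln y >= 1 - 1/y bounds it
    below by (u - v) / (u (1 + v)) for T and by (u - v) / (1 + u) for V. Both are at least the
    chord. *)
Lemma chord_le_ln_dist_drop (b : bool) (u v : R) :
  0 < u -> 0 < v -> chord u v <= ln_dist u v - ln_dist (step b u) (step b v).
Proof.
  assert (W : forall u v, 0 < v -> v <= u ->
    chord u v <= ln_dist u v - ln_dist (step b u) (step b v)).
  { clear u v. intros u v Hv Hvu. unfold chord, ln_dist.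
    pose proof (step_pos b v Hv) as Sv. pose proof (step_pos b u ltac:(lra)) as Su.
    assert (Hln : forall p q, 0 < q -> q <= p -> Rabs (ln p - ln q) = ln (p / q)).
    { intros p q Hq [Hp|Hp].
      - pose proof (ln_increasing q p Hq Hp). rewrite Rabs_pos_eq by lra.
        rewrite ln_div by lra. reflexivity.
      - rewrite Hp. unfold Rdiv. rewrite Rinv_r by lra. rewrite ln_1, Rminus_diag, Rabs_R0. reflexivity. }
    assert (Hs : step b v <= step b u).
    { destruct b; simpl; [lra|].
      assert (E : u / (u + 1) - v / (v + 1) = (u - v) / ((u + 1) * (v + 1))) by (field; lra).
      assert (0 <= (u - v) / ((u + 1) * (v + 1))); [|lra].
      apply Rmult_le_pos; [lra|]. apply Rlt_le, Rinv_0_lt_compat. nra. }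
    rewrite !Hln by assumption. rewrite Rabs_pos_eq by lra.
    assert (P1 : 0 < u / v) by (apply Rdiv_lt_0_compat; lra).
    assert (P2 : 0 < step b u / step b v) by (apply Rdiv_lt_0_compat; lra).
    rewrite <- ln_div by assumption.
    eapply Rle_trans; [|apply ln_ge_1_minus_inv; now apply Rdiv_lt_0_compat].
    destruct b; simpl.
    - replace (1 - / (u / v / ((u + 1) / (v + 1)))) with ((u - v) / (u * (1 + v))) by (field; lra).
      apply Rmult_le_compat_l; [lra|]. apply Rinv_le_contravar; nra.
    - replace (1 - / (u / v / (u / (u + 1) / (v / (v + 1))))) with ((u - v) / (1 + u)) by (field; lra).
      apply Rmult_le_compat_l; [lra|]. apply Rinv_le_contravar; nra. }
  intros Hu Hv. destruct (Rle_dec v u) as [H|H]; [now apply W|].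
  assert (E1 : forall p q, ln_dist p q = ln_dist q p) by (intros; apply Rabs_minus_sym).
  rewrite E1, (E1 (step b u)). replace (chord u v) with (chord v u).
  - apply W; lra.
  - unfold chord. rewrite Rabs_minus_sym. f_equal. ring.
Qed.

(** In a word sum the positive pole is taken after the current letter has acted, whereas the
    logarithmic drop bounds the chord before it. *)
Lemma chord_step_le (b : bool) (u v : R) :
  0 < u -> 0 < v -> chord (step b u) (step b v) <= chord u v.
Proof.
  intros Hu Hv. unfold chord. pose proof (Rabs_pos (u - v)). destruct b; simpl.
  - replace (u + 1 - (v + 1)) with (u - v) by ring.
    apply Rmult_le_compat_l; [assumption|]. apply Rinv_le_contravar; nra.
  - replace (u / (u + 1) - v / (v + 1)) with ((u - v) * / ((u + 1) * (v + 1))) by (field; lra).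
    assert (P : 0 < / ((u + 1) * (v + 1))) by (apply Rinv_0_lt_compat; nra).
    rewrite Rabs_mult, (Rabs_pos_eq (/ _)) by lra.
    unfold Rdiv. rewrite Rmult_assoc. apply Rmult_le_compat_l; [assumption|].
    replace (/ ((u + 1) * (v + 1)) * / ((1 + u * / (u + 1)) * (1 + v * / (v + 1))))
      with (/ ((1 + 2 * u) * (1 + 2 * v))).
    + apply Rinv_le_contravar; nra.
    + field. repeat split; lra.
Qed.

(** * Cycle integrals of words *)

(** The integral of f omega (- v, W e) from [rho] to W [rho], cut at the images of [rho] under the
    prefixes of W and pulled back to one arc. *)
Fixpoint word_sum (f : C -> C) (W : list bool) (v e : R) : C :=
  match W with
  | nil => RtoC 0
  | b :: W' => (arc_form f v (act (b :: W') e) + word_sum f W' (step b v) e)%C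
  end.

Lemma word_sum_app (f : C -> C) (W1 W2 : list bool) (v e : R) :
  word_sum f (W1 ++ W2) v e =
  (word_sum f W1 v (act W2 e) + word_sum f W2 (pass W1 v) e)%C.
Proof.
  revert v. induction W1 as [|b W1 IH]; intros v.
  - simpl. ring.
  - change ((arc_form f v (act ((b :: W1) ++ W2) e) + word_sum f (W1 ++ W2) (step b v) e)%C =
      ((arc_form f v (act (b :: W1) (act W2 e)) + word_sum f W1 (step b v) (act W2 e))
       + word_sum f W2 (pass W1 (step b v)) e)%C).
    rewrite IH, act_app. ring.
Qed.

Lemma word_sum_bound (f : C -> C) (S : R) (W : list bool) (v e : R) :
  holomorphic_on_H f -> (forall t, on_arc t -> Cmod (f (cis t)) <= S) ->
  Cmod (word_sum f W v e) <= S * (PI / 3) * 4 * INR (length W).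
Proof.
  intros Hf Hb. revert v. induction W as [|b W IH]; intros v.
  - simpl. rewrite Cmod_0. lra.
  - change (length (b :: W)) with (Datatypes.S (length W)). rewrite S_INR.
    change (word_sum f (b :: W) v e) with
      (arc_form f v (act (b :: W) e) + word_sum f W (step b v) e)%C.
    eapply Rle_trans; [apply Cmod_triangle|].
    pose proof (arc_form_bound f S v (act (b :: W) e) Hf Hb). specialize (IH (step b v)). lra.
Qed.

(** Two telescopes in opposite directions. The distance of the [v] falls as letters are read from
    the left; that of the positive poles falls from the right end, from [ln_dist e e1] down to the
    subtracted term, which is kept because the next letter on the left continues from it. *)
Lemma word_sum_diff_bound (f : C -> C) (S : R) (W : list bool) (v e v1 e1 : R) :
  holomorphic_on_H f -> 0 <= S -> (forall t, on_arc t -> Cmod (f (cis t)) <= S) ->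
  0 < v -> 0 < e -> 0 < v1 -> 0 < e1 ->
  Cmod (word_sum f W v e - word_sum f W v1 e1) <=
  S * (PI / 3) * (4 * (ln_dist v v1 + ln_dist e e1 - ln_dist (act W e) (act W e1))).
Proof.
  intros Hf HS Hb Hv He Hv1 He1.
  assert (HB : 0 <= S * (PI / 3)) by (pose proof PI_RGT_0; apply Rmult_le_pos; lra).
  revert v v1 Hv Hv1. induction W as [|b W IH]; intros v v1 Hv Hv1.
  - simpl. replace (RtoC 0 - RtoC 0)%C with (RtoC 0) by ring. rewrite Cmod_0.
    apply Rmult_le_pos; [exact HB|]. pose proof (Rabs_pos (ln v - ln v1)). unfold ln_dist. lra.
  - change (word_sum f (b :: W) v e) with
      (arc_form f v (act (b :: W) e) + word_sum f W (step b v) e)%C.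
    change (word_sum f (b :: W) v1 e1) with
      (arc_form f v1 (act (b :: W) e1) + word_sum f W (step b v1) e1)%C.
    specialize (IH (step b v) (step b v1) (step_pos b v Hv) (step_pos b v1 Hv1)).
    pose proof (act_pos W e He) as Pe. pose proof (act_pos W e1 He1) as Pe1.
    pose proof (arc_form_diff_bound f S v (act (b :: W) e) v1 (act (b :: W) e1) Hf Hb Hv
      (step_pos b _ Pe) Hv1 (step_pos b _ Pe1)) as HA.
    change (act (b :: W) e) with (step b (act W e)) in *.
    change (act (b :: W) e1) with (step b (act W e1)) in *.
    pose proof (chord_le_ln_dist_drop b v v1 Hv Hv1) as D1.
    pose proof (chord_le_ln_dist_drop b _ _ Pe Pe1) as D2.
    pose proof (chord_step_le b _ _ Pe Pe1) as D3.
    set (B := S * (PI / 3)) in *.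
    match goal with |- Cmod (?a + ?b - (?c + ?d)) <= _ =>
      replace (a + b - (c + d))%C with ((a - c) + (b - d))%C by ring end.
    eapply Rle_trans; [apply Cmod_triangle|]. eapply Rle_trans; [apply Rplus_le_compat; eassumption|].
    rewrite <- Rmult_plus_distr_l. apply Rmult_le_compat_l; [exact HB|]. lra.
Qed.

Lemma moebR_letter (b : bool) (v : R) :
  0 < v -> IZR (mc (letter_mat b)) * - step b v + IZR (md (letter_mat b)) <> 0 /\
  moebR (letter_mat b) (- step b v) = - v.
Proof.
  intros Hv. unfold moebR. destruct b; simpl.
  - split; [lra|field].
  - assert (E : 1 * - (v / (v + 1)) + 1 = / (v + 1)) by (field; lra).
    assert (0 < / (v + 1)) by (apply Rinv_0_lt_compat; lra).
    split; [lra|]. rewrite E. field. lra.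
Qed.

Lemma moebR_letter_pos (b : bool) (y : R) :
  0 < y -> IZR (mc (letter_mat b)) * y + IZR (md (letter_mat b)) <> 0 /\
  moebR (letter_mat b) y = step b y.
Proof.
  intros Hy. unfold moebR. destruct b; simpl; (split; [lra|field; lra]).
Qed.

(** The path to b W [rho] passes through b [rho] = [rho']. Its first piece is one arc term; the
    rest, pulled back by the letter b, is the path to W [rho] for the form with poles - [step b v]
    and W e. *)
Lemma word_sum_primitive (f G : C -> C) (W : list bool) (v e : R) :
  weakly_holomorphic_modular f -> 0 < v -> 0 < e ->
  primitive_on_H f G (- v) (act W e) ->
  (G (moebC (word_mat W) rho) - G rho)%C = word_sum f W v e.
Proof.
  intros Hf Hv He. revert G v Hv. induction W as [|b W IH]; intros G v Hv HG.
  - replace (moebC (word_mat nil) rho) with rho.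
    + simpl. ring.
    + unfold moebC. simpl. field.
  - change (act (b :: W) e) with (step b (act W e)) in HG.
    pose proof (act_pos W e He) as Pe.
    destruct (moebR_letter b v Hv) as [N1 E1]. destruct (moebR_letter_pos b _ Pe) as [N2 E2].
    assert (HG' : primitive_on_H f (fun z => G (moebC (letter_mat b) z)) (- step b v) (act W e)).
    { apply primitive_moeb; auto using letter_mat_SL2Z. now rewrite E1, E2. }
    specialize (IH _ _ (step_pos b v Hv) HG').
    change (word_sum f (b :: W) v e) with
      (arc_form f v (step b (act W e)) + word_sum f W (step b v) e)%C.
    rewrite <- IH, (arc_form_primitive f G) by first [assumption | exact (whm_holomorphic f Hf)].
    change (word_mat (b :: W)) with (mat2_mul (letter_mat b) (word_mat W)).
    rewrite moebC_mul by first [apply letter_mat_SL2Z | apply word_mat_nonneg | apply rho_upper].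
    rewrite moebC_letter_rho. ring.
Qed.

Lemma cycle_integral_word (W : list bool) :
  hyperbolic (word_mat W) ->
  exists v e, 0 < v /\ 0 < e /\ act W e = e /\
    forall f tau0, weakly_holomorphic_modular f -> upper_half_plane tau0 ->
      cycle_integral f tau0 (word_mat W) = word_sum f W v e.
Proof.
  intros Hh. pose proof (word_mat_nonneg W) as HW.
  destruct (cycle_form_kern _ HW Hh) as (w & e & Hw & He & HK).
  pose proof (repelling_neg _ _ HW Hw) as Pw. pose proof (attracting_pos _ _ HW He) as Pe.
  assert (Ee : act W e = e) by (rewrite <- moebR_word_mat by exact Pe; apply He).
  exists (- w), e. split; [lra|]. split; [exact Pe|]. split; [exact Ee|].
  intros f tau0 Hf H0.
  destruct (primitive_exists f w e (whm_holomorphic f Hf)) as [G HG].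
  rewrite (cycle_integral_primitive f tau0 rho _ Hf H0 rho_upper HW Hh w e G Hw He HK HG).
  apply word_sum_primitive; try assumption; [lra|]. now rewrite Ropp_involutive, Ee.
Qed.

(** One arc per letter, and the default value 0 for a word that is not hyperbolic. It serves the
    indices n shorter than the prefix. *)
Lemma cycle_integral_word_bound (f : C -> C) (S : R) (tau0 : C) (W : list bool) :
  weakly_holomorphic_modular f -> upper_half_plane tau0 ->
  0 <= S -> (forall t, on_arc t -> Cmod (f (cis t)) <= S) ->
  Cmod (cycle_integral f tau0 (word_mat W)) <= S * (PI / 3) * 4 * INR (length W).
Proof.
  intros Hf H0 HS Hb. destruct (hyperbolic_dec (word_mat W)) as [Hh|Hn].
  - destruct (cycle_integral_word W Hh) as (v & e & _ & _ & _ & E). rewrite E by assumption.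
    apply word_sum_bound; try assumption. exact (whm_holomorphic f Hf).
  - unfold cycle_integral. destruct (hyperbolic_dec (word_mat W)); [contradiction|].
    rewrite Cmod_0. apply Rmult_le_pos; [now apply arc_constant_nonneg|apply pos_INR].
Qed.

(** * The telescoping estimate *)

(** V adds 1 to the reciprocal 1/y, and T makes the reciprocal less than 1; so after a T it is at
    most the number of letters. The next lemma is the mirror image under y -> 1/y. *)
Lemma act_ge (W : list bool) (y : R) : 0 < y -> In true W -> 1 <= act W y * INR (length W).
Proof.
  intros Hy. induction W as [|b W IH]; [intros []|]. intros Hin.
  change (act (b :: W) y) with (step b (act W y)).
  change (length (b :: W)) with (Datatypes.S (length W)). rewrite S_INR.
  pose proof (act_pos W y Hy) as Pa. pose proof (pos_INR (length W)) as Pl.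
  destruct b; simpl; [nra|].
  destruct Hin as [Hin|Hin]; [discriminate|]. specialize (IH Hin).
  apply Rmult_le_reg_r with (act W y + 1); [lra|].
  replace (act W y / (act W y + 1) * (INR (length W) + 1) * (act W y + 1))
    with (act W y * (INR (length W) + 1)) by (field; lra). lra.
Qed.

Lemma act_le (W : list bool) (y : R) : 0 < y -> In false W -> act W y <= INR (length W).
Proof.
  intros Hy. induction W as [|b W IH]; [intros []|]. intros Hin.
  change (act (b :: W) y) with (step b (act W y)).
  change (length (b :: W)) with (Datatypes.S (length W)). rewrite S_INR.
  pose proof (act_pos W y Hy) as Pa. pose proof (pos_INR (length W)) as Pl.
  destruct b; simpl.
  - destruct Hin as [Hin|Hin]; [discriminate|]. specialize (IH Hin). lra.
  - apply Rle_div_l; [lra|]. nra.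
Qed.

Lemma act_ge_of_no_V (W : list bool) (y : R) :
  0 < y -> ~ In false W -> INR (length W) <= act W y.
Proof.
  intros Hy. induction W as [|b W IH]; intros Hin.
  - simpl. lra.
  - change (act (b :: W) y) with (step b (act W y)).
    change (length (b :: W)) with (Datatypes.S (length W)). rewrite S_INR.
    destruct b; [|exfalso; apply Hin; now left]. simpl.
    assert (INR (length W) <= act W y) by (apply IH; intros H; apply Hin; now right). lra.
Qed.

Lemma act_le_of_no_T (W : list bool) (y : R) :
  0 < y -> ~ In true W -> act W y * INR (length W) <= 1.
Proof.
  intros Hy. induction W as [|b W IH]; intros Hin.
  - simpl. lra.
  - change (act (b :: W) y) with (step b (act W y)).
    change (length (b :: W)) with (Datatypes.S (length W)). rewrite S_INR.
    destruct b; [exfalso; apply Hin; now left|]. simpl.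
    assert (act W y * INR (length W) <= 1) by (apply IH; intros H; apply Hin; now right).
    pose proof (act_pos W y Hy) as Pa.
    apply Rmult_le_reg_r with (act W y + 1); [lra|].
    replace (act W y / (act W y + 1) * (INR (length W) + 1) * (act W y + 1))
      with (act W y * (INR (length W) + 1)) by (field; lra). lra.
Qed.

Lemma pass_act_rev (W : list bool) (v : R) : pass W v = act (rev W) v.
Proof. unfold pass, act. now rewrite <- fold_left_rev_right. Qed.

Lemma Rabs_ln_le (y N : R) : 0 < y -> 0 < N -> y <= N -> 1 <= y * N -> Rabs (ln y) <= ln N.
Proof.
  intros Hy HN H1 H2. apply Rabs_le. split.
  - assert (0 <= ln y + ln N); [|lra]. rewrite <- ln_mult, <- ln_1 by assumption.
    apply ln_le; lra.
  - now apply ln_le.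
Qed.

Lemma ln_dist_le (u v N : R) :
  0 < u -> 0 < v -> 0 < N -> u <= N -> v <= N -> 1 <= u * N -> 1 <= v * N ->
  ln_dist u v <= 2 * ln N.
Proof.
  intros. unfold ln_dist, Rminus. eapply Rle_trans; [apply Rabs_triang|]. rewrite Rabs_Ropp.
  pose proof (Rabs_ln_le u N). pose proof (Rabs_ln_le v N). lra.
Qed.

(** A T makes the upper right entry positive and a V the lower left one; then a d = 1 + b c >= 2, so
    the trace is at least 3. *)
Lemma word_mat_hyperbolic (W : list bool) :
  In true W -> In false W -> hyperbolic (word_mat W).
Proof.
  assert (HT : In true W -> (0 < mb (word_mat W))%Z).
  { induction W as [|b W IH]; [intros []|]. intros Hin.
    change (word_mat (b :: W)) with (mat2_mul (letter_mat b) (word_mat W)).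
    destruct (word_mat_nonneg W) as (_ & _ & Hb & _ & _).
    destruct (SL2Z_nonneg_diag _ (word_mat_nonneg W)) as [_ Hd]. apply le_IZR in Hd.
    destruct b; cbn [mat2_mul letter_mat matT matV ma mb mc md]; [lia|].
    destruct Hin as [Hin|Hin]; [discriminate|]. specialize (IH Hin). lia. }
  assert (HV : In false W -> (0 < mc (word_mat W))%Z).
  { clear HT. induction W as [|b W IH]; [intros []|]. intros Hin.
    change (word_mat (b :: W)) with (mat2_mul (letter_mat b) (word_mat W)).
    destruct (word_mat_nonneg W) as (_ & _ & _ & Hc & _).
    destruct (SL2Z_nonneg_diag _ (word_mat_nonneg W)) as [Ha _]. apply le_IZR in Ha.
    destruct b; cbn [mat2_mul letter_mat matT matV ma mb mc md]; [|lia].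
    destruct Hin as [Hin|Hin]; [discriminate|]. specialize (IH Hin). lia. }
  intros I1 I2. specialize (HT I1). specialize (HV I2).
  destruct (word_mat_nonneg W) as (HS & Ha & _ & _ & Hd).
  unfold SL2Z, mat2_det in HS. unfold hyperbolic, mat2_trace.
  assert (1 <= mb (word_mat W) * mc (word_mat W))%Z by nia.
  assert (2 <= ma (word_mat W) * md (word_mat W))%Z by lia. nia.
Qed.

(* Until the letters of W0 have been read, the repelling fixed points need not lie
   in a compact set, whence the separate crude bound for these letters. *)
Lemma cycle_integral_prefix_bound (f : C -> C) (S : R) (tau0 : C) (Wm W0 W1 : list bool) :
  weakly_holomorphic_modular f -> upper_half_plane tau0 ->
  0 <= S -> (forall t, on_arc t -> Cmod (f (cis t)) <= S) ->
  In true W0 -> In false W0 ->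
  let m := INR (length Wm) in let N := INR (length W0) in
  Cmod (cycle_integral f tau0 (word_mat (Wm ++ W0 ++ W1))
        - cycle_integral f tau0 (word_mat (W0 ++ W1)))
  <= S * (PI / 3) * 4 * (m + 2 * N + 4 * ln (m + N)).
Proof.
  intros Hf H0 HS Hb HT HV m N.
  assert (Hol : holomorphic_on_H f) by exact (whm_holomorphic f Hf).
  assert (HB : 0 <= S * (PI / 3) * 4) by now apply arc_constant_nonneg.
  destruct (cycle_integral_word (W0 ++ W1)) as (v & e & Hv & He & Ee & E).
  { apply word_mat_hyperbolic; apply in_or_app; auto. }
  destruct (cycle_integral_word (Wm ++ W0 ++ W1)) as (v1 & e1 & Hv1 & He1 & Ee1 & E1).
  { apply word_mat_hyperbolic; apply in_or_app; right; apply in_or_app; auto. }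
  rewrite E, E1 by assumption. clear E E1.
  rewrite !word_sum_app. rewrite act_app in Ee. rewrite !act_app in Ee1.
  (* The repelling parameter once the letters of M have been read; from here on both words are
     [W0 ++ W1]. *)
  set (v2 := pass Wm v1). assert (Hv2 : 0 < v2) by now apply pass_pos.
  pose proof (word_sum_bound f S Wm v1 (act (W0 ++ W1) e1) Hol Hb) as B1.
  pose proof (word_sum_bound f S W0 v2 (act W1 e1) Hol Hb) as B2.
  pose proof (word_sum_bound f S W0 v (act W1 e) Hol Hb) as B3.
  assert (Hp : 0 < pass W0 v) by now apply pass_pos.
  assert (Hp2 : 0 < pass W0 v2) by now apply pass_pos.
  pose proof (word_sum_diff_bound f S W1 (pass W0 v2) e1 (pass W0 v) e Hol HS Hb Hp2 He1 Hp He) as B4.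
  assert (Hm : 0 <= m) by apply pos_INR.
  assert (HN : 1 <= N).
  { unfold N. destruct W0 as [|b W0]; [destruct HT|].
    change (length (b :: W0)) with (Datatypes.S (length W0)). rewrite S_INR.
    pose proof (pos_INR (length W0)). lra. }
  assert (HTr : In true (rev W0)) by (rewrite <- in_rev; exact HT).
  assert (HVr : In false (rev W0)) by (rewrite <- in_rev; exact HV).
  (* [pass] is the action of the reversed word, which contains both letters as well, so the bound
     holds whatever positive [u] is. *)
  assert (Hpass : forall u, 0 < u -> pass W0 u <= m + N /\ 1 <= pass W0 u * (m + N)).
  { intros u Hu. rewrite pass_act_rev.
    pose proof (act_le _ u Hu HVr) as L1. pose proof (act_ge _ u Hu HTr) as L2.
    pose proof (act_pos (rev W0) u Hu).
    rewrite length_rev in L1, L2. fold N in L1, L2. split; [lra|nra]. }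
  (* Being fixed by its word, [e] is a value of [act W0], and [e1] one of [act (Wm ++ W0)]; the
     latter has length m + N, hence the common bound. *)
  assert (Le : e <= m + N /\ 1 <= e * (m + N)).
  { pose proof (act_pos W1 e He) as P. pose proof (act_le _ _ P HV) as L1.
    pose proof (act_ge _ _ P HT) as L2. rewrite Ee in L1, L2. fold N in L1, L2. split; [lra|nra]. }
  assert (Le1 : e1 <= m + N /\ 1 <= e1 * (m + N)).
  { pose proof (act_pos W1 e1 He1) as P.
    assert (L1 : act (Wm ++ W0) (act W1 e1) <= INR (length (Wm ++ W0)))
      by (apply act_le; [exact P|apply in_or_app; auto]).
    assert (L2 : 1 <= act (Wm ++ W0) (act W1 e1) * INR (length (Wm ++ W0)))
      by (apply act_ge; [exact P|apply in_or_app; auto]).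
    rewrite length_app, plus_INR, act_app, Ee1 in L1, L2. auto. }
  destruct (Hpass v Hv) as [A1 A2]. destruct (Hpass v2 Hv2) as [A3 A4].
  destruct Le as [A5 A6]. destruct Le1 as [A7 A8].
  assert (D1 : ln_dist (pass W0 v2) (pass W0 v) <= 2 * ln (m + N)) by (apply ln_dist_le; lra).
  assert (D2 : ln_dist e1 e <= 2 * ln (m + N)) by (apply ln_dist_le; lra).
  assert (D3 : 0 <= ln_dist (act W1 e1) (act W1 e)) by apply Rabs_pos.
  assert (B4' : Cmod (word_sum f W1 (pass W0 v2) e1 - word_sum f W1 (pass W0 v) e)
    <= S * (PI / 3) * 4 * (4 * ln (m + N))).
  { eapply Rle_trans; [exact B4|]. rewrite <- Rmult_assoc. apply Rmult_le_compat_l; [exact HB|]. lra. }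
  fold m in B1. fold N in B2, B3.
  (* [Wm] costs m arcs, [W0] costs N arcs in each of the two sums, and only the parts over [W1] are
     compared termwise. *)
  match goal with |- Cmod (?a + (?b + ?c) - (?b1 + ?c1)) <= _ =>
    replace (a + (b + c) - (b1 + c1))%C with (a + b + - b1 + (c - c1))%C by ring end.
  eapply Rle_trans; [apply Cmod_triangle|].
  eapply Rle_trans; [apply Rplus_le_compat_r, Cmod_triangle|]. rewrite Cmod_opp.
  eapply Rle_trans; [apply Rplus_le_compat_r, Rplus_le_compat_r, Cmod_triangle|]. lra.
Qed.

(** * The supremum on the arc, and the infinite word attached to x *)

Lemma Cmod_arc_le_arc_sup (f : C -> C) (t : R) :
  weakly_holomorphic_modular f -> on_arc t -> Cmod (f (cis t)) <= arc_sup f.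
Proof.
  intros Hf Ht.
  destruct (continuity_ab_maj (fun s => Cmod (f (cis s))) (PI / 3) (2 * PI / 3)) as (tm & Hm & _).
  - pose proof PI_RGT_0. lra.
  - intros s Hs.
    assert (Hc : continuous (U := C_R_NormedModule) (fun s => f (cis s)) s).
    { apply holomorphic_continuous_path; [apply (whm_holomorphic f Hf), cis_upper, Hs|].
      apply (ex_derive_continuous (K := R_AbsRing) (V := C_R_NormedModule)).
      eexists. apply path_derive_cis. }
    rewrite continuous_path_iff in Hc. intros eps He. destruct (Hc eps He) as (d & Hd & H).
    exists d. split; [exact Hd|]. intros y [_ Hy]. simpl in *. unfold R_dist in *.
    eapply Rle_lt_trans; [|apply (H y Hy)].
    apply Rabs_le. split.
    + assert (Cmod (f (cis s)) <= Cmod (f (cis y)) + Cmod (f (cis y) - f (cis s))); [|lra].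
      replace (f (cis s)) with (f (cis y) + - (f (cis y) - f (cis s)))%C at 1 by ring.
      eapply Rle_trans; [apply Cmod_triangle|]. rewrite Cmod_opp. lra.
    + assert (Cmod (f (cis y)) <= Cmod (f (cis s)) + Cmod (f (cis y) - f (cis s))); [|lra].
      replace (f (cis y)) with (f (cis s) + (f (cis y) - f (cis s)))%C at 1 by ring.
      apply Cmod_triangle.
  - unfold arc_sup.
    set (E := fun y : R => exists t : R, PI / 3 <= t <= 2 * PI / 3 /\ y = Cmod (f (cis t))).
    (* [real] sends infinite values to 0, so the least upper bound must be shown finite; the maximum
       attained at [tm] bounds it. *)
    destruct (Lub_Rbar_correct E) as [Hub Hlub].
    assert (H1 : Rbar_le (Cmod (f (cis t))) (Lub_Rbar E)) by (apply Hub; exists t; auto).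
    assert (H2 : Rbar_le (Lub_Rbar E) (Cmod (f (cis tm)))).
    { apply Hlub. intros y (s & Hs & ->). apply Hm, Hs. }
    destruct (Lub_Rbar E); simpl in *; [exact H1|contradiction|contradiction].
Qed.

(** Each step multiplies on the right, so new letters are appended and all words are prefixes of a
    single infinite word [l]. *)
Lemma associated_sequence_word (x : R) (A : nat -> mat2) :
  associated_sequence x A ->
  exists l : nat -> bool, forall n, A n = word_mat (map l (seq 0 n)).
Proof.
  intros HA.
  exists (fun n => if excluded_middle_informative (letter A n = matT) then true else false).
  induction n as [|n IH]; [apply (as_start x A HA)|].
  rewrite seq_S, map_app, word_mat_app, <- IH. cbn [map].
  assert (E : letter A n = letter_mat
    (if excluded_middle_informative (letter A n = matT) then true else false)).
  { destruct (excluded_middle_informative _) as [E|E]; [exact E|].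
    destruct (as_step x A HA n); [contradiction|assumption]. }
  change (0 + n)%nat with n.
  set (b := if excluded_middle_informative (letter A n = matT) then true else false) in *.
  assert (Eb : word_mat (b :: nil) = letter_mat b) by (destruct b; reflexivity).
  rewrite Eb, <- E. unfold letter. rewrite mat2_mul_assoc.
  replace (mat2_mul (A n) (mat2_inv (A n))) with mat2_one; [symmetry; apply mat2_mul_one_l|].
  destruct (as_SL2 x A HA n) as [HS _]. unfold SL2Z, mat2_det in HS.
  unfold mat2_one, mat2_mul, mat2_inv. cbn [ma mb mc md]. f_equal; lia.
Qed.

(** If the first N letters were all V, every later value at 1 would be at most 1/N, and so would x;
    if they were all T, x would be at least N. *)
Lemma associated_prefix_letters (x : R) (l : nat -> bool) (N : nat) :
  is_lim_seq (fun n => act (map l (seq 0 n)) 1) x -> 0 < x -> x < INR N -> / x < INR N ->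
  In true (map l (seq 0 N)) /\ In false (map l (seq 0 N)).
Proof.
  intros Hlim Hx H1 H2. apply (is_lim_seq_incr_n _ N) in Hlim.
  assert (E : forall k, map l (seq 0 (k + N)) = map l (seq 0 N) ++ map l (seq N k)).
  { intros k. rewrite Nat.add_comm, seq_app, map_app. reflexivity. }
  assert (HL : length (map l (seq 0 N)) = N) by now rewrite length_map, length_seq.
  split.
  - destruct (in_dec bool_dec true (map l (seq 0 N))) as [H|H]; [exact H|exfalso].
    assert (Hle : x <= / INR N).
    { refine (is_lim_seq_le _ (fun _ => / INR N) x (/ INR N) _ Hlim (is_lim_seq_const _)).
      intros k. rewrite E, act_app.
      pose proof (act_le_of_no_T _ _ (act_pos (map l (seq N k)) 1 Rlt_0_1) H) as L.
      rewrite HL in L. apply Rmult_le_reg_r with (INR N); [lra|].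
      rewrite Rinv_l by lra. exact L. }
    apply Rinv_le_contravar in Hle; [|exact Hx]. rewrite Rinv_inv in Hle. lra.
  - destruct (in_dec bool_dec false (map l (seq 0 N))) as [H|H]; [exact H|exfalso].
    assert (Hle : INR N <= x).
    { refine (is_lim_seq_le (fun _ => INR N) _ (INR N) x _ (is_lim_seq_const _) Hlim).
      intros k. rewrite E, act_app.
      pose proof (act_ge_of_no_V _ _ (act_pos (map l (seq N k)) 1 Rlt_0_1) H) as L.
      rewrite HL in L. exact L. }
    lra.
Qed.

Theorem theorem2p6 :
  forall (x : R) (M : mat2),
    0 < x -> SL2Z_nonneg M ->
    exists K : R, 0 < K /\
      forall A : nat -> mat2, associated_sequence x A ->
      forall (f : C -> C) (tau0 : C) (n : nat),
        weakly_holomorphic_modular f ->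
        upper_half_plane tau0 ->
        Cmod (cycle_integral f tau0 (mat2_mul M (A n))
              - cycle_integral f tau0 (A n))%C
        <= K * arc_sup f.
Proof.
  intros x M Hx HM. destruct (nonneg_word M HM) as [Wm ->].
  (* [N] exceeds both x and 1/x, and it depends on x alone, so the constant is fixed before the
     sequence. *)
  destruct (INR_unbounded (x + / x)) as [N HN].
  assert (Hix : 0 < / x) by now apply Rinv_0_lt_compat.
  pose proof (pos_INR (length Wm)) as Hm. pose proof PI_RGT_0 as HPI.
  set (m := INR (length Wm)) in *.
  assert (HN1 : 1 <= INR N).
  { change 1 with (INR 1). apply le_INR. destruct N; [simpl in HN; lra|lia]. }
  assert (Hln : 0 <= ln (m + INR N)) by (rewrite <- ln_1; apply ln_le; lra).
  exists (PI / 3 * 4 * (m + 2 * INR N + 4 * ln (m + INR N))). split.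
  { apply Rmult_lt_0_compat; lra. }
  intros A HA f tau0 n Hf H0.
  destruct (associated_sequence_word x A HA) as [l Hl].
  assert (Hlim : is_lim_seq (fun n => act (map l (seq 0 n)) 1) x).
  { apply is_lim_seq_ext with (2 := as_limit x A HA). intros k.
    rewrite Hl. apply moebR_word_mat, Rlt_0_1. }
  destruct (associated_prefix_letters x l N Hlim Hx) as [HT HV]; [lra|lra|].
  assert (Hb : forall t, on_arc t -> Cmod (f (cis t)) <= arc_sup f)
    by (intros t; now apply Cmod_arc_le_arc_sup).
  assert (HS : 0 <= arc_sup f).
  { apply Rle_trans with (Cmod (f (cis (PI / 3)))); [apply Cmod_ge_0|]. apply Hb.
    unfold on_arc. lra. }
  set (S := arc_sup f) in *.
  rewrite Hl, <- word_mat_app.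
  destruct (Nat.le_gt_cases N n) as [HNn|HnN].
  - replace n with (N + (n - N))%nat by lia. rewrite seq_app, map_app.
    eapply Rle_trans; [apply cycle_integral_prefix_bound with (S := S); assumption|].
    rewrite length_map, length_seq. fold m. right. ring.
  (* For n < N the prefix is not yet complete, but the two words have only m + n and n letters;
     their total stays below m + 2 N, and the logarithmic term is nonnegative. *)
  - unfold Cminus. eapply Rle_trans; [apply Cmod_triangle|]. rewrite Cmod_opp.
    pose proof (cycle_integral_word_bound f S tau0 (Wm ++ map l (seq 0 n)) Hf H0 HS Hb) as B1.
    pose proof (cycle_integral_word_bound f S tau0 (map l (seq 0 n)) Hf H0 HS Hb) as B2.
    rewrite length_app, plus_INR in B1. rewrite length_map, length_seq in B1, B2. fold m in B1.
    apply lt_INR in HnN.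
    apply Rle_trans with (S * (PI / 3) * 4 * (m + INR n + INR n)); [lra|].
    replace (PI / 3 * 4 * (m + 2 * INR N + 4 * ln (m + INR N)) * S)
      with (S * (PI / 3) * 4 * (m + 2 * INR N + 4 * ln (m + INR N))) by ring.
    apply Rmult_le_compat_l; [now apply arc_constant_nonneg|lra].
Qed.
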